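(* Let $Y,V$ be separable Hilbert spaces ($V$ infinite-dimensional), let $\Omega$ be a compact metric space, let $\mu$ be a Borel probability measure on $\Omega\times Y$, and let $\rho$ be the marginal Borel probability measure on $\Omega$ induced by $\mu$. Assume that $$\mathbb{E}(\|y\|_Y^2)=\int_{\Omega\times Y}\|y\|_Y^2\,d\mu(\omega,y)<\infty .$$ Let $\mathbf{R}=\{R_\omega\}_{\omega\in\Omega}$ be a family of bounded linear operators $R_\omega:Y\to V$ which is weakly measurable (i.e. $\omega\mapsto (R_\omega y,v)_V$ is Borel measurable on $\Omega$ for each $(y,v)\in Y\times V$) and uniformly bounded: $$\|R_\omega\|_{Y\to V}^2\le\Lambda<\infty,\qquad \omega\in\Omega .$$ Assume that the operator $P_\rho=\mathbb{E}(R_\omega R_\omega^\ast):V\to V$ is injective and compact. Assume further that $\mathbb{E}(R_\omega y)\in\mathrm{ran}(P_\rho)$, let $u\in V$ be the unique solution of $P_\rho u=\mathbb{E}(R_\omega y)$, and assume that $u\in V_{P_\rho}^s$ for some $0<s\le 1$. Let $(\omega_m,y_m)$, $m=0,1,\ldots,N\le\infty$, be random samples that are i.i.d. with respect to $\mu$. Let $u^{(0)}\in V$ be arbitrary and define $$u^{(m+1)}=\alpha_m\bigl(u^{(m)}+\mu_m R_{\omega_m}(y_m-R_{\omega_m}^\ast u^{(m)})\bigr),\qquad \alpha_m=\frac{m+1}{m+2},\quad \mu_m=\frac{A}{(m+1)^{t}},\qquad m=0,1,\ldots,N,$$ with $t=t_s:=(1+s)/(2+s)$ and $A=1/(2\Lambda)$.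 Then the expected squared error satisfies $$\mathbb{E}(\|u-u^{(m)}\|_V^2)=\mathbb{E}(\|f_u-f^{(m)}\|_H^2)\le C^2 (m+1)^{-s/(2+s)},\qquad m=1,2,\ldots,N+1,$$ where $f^{(m)}=f_{u^{(m)}}$ and $$C^2=2\|u-u^{(0)}\|_V^2+2\|u\|_V^2+8\Lambda^s\|u\|_{V_{P_\rho}^s}^2+\sigma_H^2/\Lambda .$$
   Context: Here $R_\omega^\ast:V\to Y$ is the Hilbert adjoint of $R_\omega$. The expectations $\mathbb{E}(R_\omega R_\omega^\ast)$ and $\mathbb{E}(R_\omega y)$ are taken with respect to $\mu$: $P_\rho$ is the bounded self-adjoint nonnegative operator on $V$ determined by $(P_\rho v,w)_V=\int_\Omega (R_\omega^\ast v,R_\omega^\ast w)_Y\,d\rho(\omega)$ for all $v,w\in V$, and $\mathbb{E}(R_\omega y)\in V$ is the Bochner integral $\int_{\Omega\times Y}R_\omega y\,d\mu(\omega,y)$. The expectations of errors are over the random samples. For $v\in V$, $f_v:\Omega\to Y$ is $f_v(\omega):=R_\omega^\ast v$. The vector-valued reproducing kernel Hilbert space is $H:=\{f_v:\ v\in V\}$ with norm $\|f_v\|_H:=\|v\|_V$ (since $P_\rho$ is injective, $v\mapsto f_v$ is injective, so this is well defined and $H$ and $V$ are isometric). The element $u$ is also the unique minimizer over $v\in V$ of $J(v)=\int_{\Omega\times Y}\|R_\omega^\ast v-y\|_Y^2\,d\mu(\omega,y)$. The noise variance is $$\sigma_H^2:=\mathbb{E}(\|y-R_\omega^\ast u\|_Y^2)=\int_{\Omega\times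 Y}\|y-R_\omega^\ast u\|_Y^2\,d\mu(\omega,y)<\infty.$$ Smoothness spaces: let $\{\psi_k\}$ be a complete orthonormal system of $V$ consisting of eigenvectors of the compact injective operator $P_\rho$, with eigenvalues $\lambda_1\ge\lambda_2\ge\ldots>0$, $\lambda_k\to 0$. For $s>0$, $V_{P_\rho}^s\subset V$ is the space of all $v=\sum_k c_k\psi_k\in V$ with $\|v\|_{V_{P_\rho}^s}^2:=\sum_k\lambda_k^{-s}|c_k|^2<\infty$ (equivalently, the completion of $\mathrm{span}\{\psi_k\}$ in this norm). *)

(* Defs.v *)
From HB Require Import structures.
From mathcomp Require Import all_boot all_order all_algebra.
From mathcomp Require Import complex.
From mathcomp Require Import all_classical all_reals all_analysis.

Set Implicit Arguments.
Unset Strict Implicit.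
Unset Printing Implicit Defensive.

Import Order.TTheory GRing.Theory Num.Theory.
Import numFieldNormedType.Exports.

Local Open Scope classical_set_scope.
Local Open Scope ring_scope.

(* Hilbert spaces are treated simultaneously over the real and over the complex
   numbers: scalars k R is R or R[i] according to k. *)
Variant scalar_kind := RealScalars | ComplexScalars.

Definition scalars (k : scalar_kind) (R : realType) : numFieldType :=
  match k with
  | RealScalars => R
  | ComplexScalars => R[i]
  end.

Definition sre {k : scalar_kind} {R : realType} : scalars k R -> R :=
  match k return scalars k R -> R with
  | RealScalars => fun x => x
  | ComplexScalars => @complex.Re R
  end.

Definition sim {k : scalar_kind} {R : realType} : scalars k R -> R :=
  match k return scalars k R -> R with
  | RealScalars => fun _ => 0
  | ComplexScalars => @complex.Im R
  end.

Definition sconj {k : scalar_kind} {R : realType} :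
    scalars k R -> scalars k R :=
  match k return scalars k R -> scalars k R with
  | RealScalars => fun x => x
  | ComplexScalars => @conjc R
  end.

Definition smk (k : scalar_kind) (R : realType) : R -> R -> scalars k R :=
  match k return R -> R -> scalars k R with
  | RealScalars => fun a _ => a
  | ComplexScalars => @Complex R
  end.

Definition of_real (k : scalar_kind) (R : realType) (a : R) : scalars k R :=
  smk k a 0.

(* The inner product is linear in its first argument and conjugate-linear in its
   second one; it induces the norm of the underlying Banach space. *)
HB.mixin Record Banach_isHilbert (k : scalar_kind) (R : realType) V
    of CompleteNormedModule (scalars k R) V := {
  inner : V -> V -> scalars k R ;
  inner_linearl : forall (a : scalars k R) (x y z : V),
    inner (a *: x + y) z = a * inner x z + inner y z ;
  inner_conjC : forall x y : V, inner y x = sconj (inner x y) ;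
  inner_normE : forall x : V, inner x x = `|x| ^+ 2
}.

#[short(type="hilbertType")]
HB.structure Definition Hilbert (k : scalar_kind) (R : realType) :=
  {V of CompleteNormedModule (scalars k R) V & Banach_isHilbert k R V}.

(* The norm of the library takes its values in the scalar field; hnorm is the
   same number as an element of R. *)
Definition hnorm (k : scalar_kind) (R : realType)
    (V : normedModType (scalars k R)) (x : V) : R := sre `|x|.

Definition separable (T : topologicalType) : Prop :=
  exists2 D : set T, countable D & dense D.

Definition infinite_dimensional (K : numFieldType) (V : lmodType K) : Prop :=
  ~ exists (n : nat) (e : 'I_n -> V),
      forall v : V, exists c : 'I_n -> K, v = \sum_i c i *: e i.

(* Measurable types are pointed in the library; as only metric spaces carrying a
   probability measure are considered, this excludes nothing. *)
#[short(type="pmetricType")]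
HB.structure Definition PointedMetric (K : numDomainType) :=
  {M of Metric K M & Pointed M}.

HB.instance Definition _ (T U : ptopologicalType) :=
  Pointed.on (T * U)%type.

Definition borel (T : ptopologicalType) := g_sigma_algebraType (@open T).

Section operators.
Variables (k : scalar_kind) (R : realType).

(* Only meaningful for bounded operators: sup is 0 on unbounded sets. *)
Definition opnorm (V W : normedModType (scalars k R)) (T : V -> W) : R :=
  sup [set hnorm (T x) | x in [set x : V | hnorm x <= 1]].

Definition is_adjoint (V W : hilbertType k R) (T : V -> W) (T' : W -> V) : Prop :=
  forall (x : V) (y : W), inner (T x) y = inner x (T' y).

Definition compact_operator (V W : normedModType (scalars k R)) (T : V -> W) : Prop :=
  precompact (T @` [set x : V | hnorm x <= 1]).

Definition complete_orthonormal (V : hilbertType k R) (psi : nat -> V) : Prop :=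
  (forall i j : nat, inner (psi i) (psi j) = (i == j)%:R) /\
  dense [set v : V | exists (n : nat) (c : nat -> scalars k R),
                       v = \sum_(i < n) c i *: psi i].

(* \sum_i (lam i)^(-s) |c_i|^2, where c_i = (v, psi_i) are the coefficients of v
   in the complete orthonormal system psi *)
Definition smoothness_norm2 (V : hilbertType k R) (psi : nat -> V) (lam : nat -> R)
    (s : R) (v : V) : \bar R :=
  (\sum_(0 <= i <oo) (lam i `^ (- s) * sre `|inner v (psi i)| ^+ 2)%:E)%E.

End operators.

Section integrals.
Variables (k : scalar_kind) (R : realType).
Context (d : measure_display) (T : measurableType d).
Variable mu : {measure set T -> \bar R}.

Definition scalar_integral (f : T -> scalars k R) : scalars k R :=
  smk k (Rintegral mu setT (sre \o f)) (Rintegral mu setT (sim \o f)).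

(* A simple function is given by a finite list of pairs (A, v), standing for
   the sum of the functions 1_A v. *)
Definition simple_fun (V : normedModType (scalars k R)) (l : seq (set T * V))
    (z : T) : V :=
  \sum_(p <- l) (\1_(p.1) z : scalars k R) *: p.2.

Definition simple_integral (V : normedModType (scalars k R))
    (l : seq (set T * V)) : V :=
  \sum_(p <- l) of_real k (fine (mu p.1)) *: p.2.

(* I is the limit of the integrals of simple functions that converge to f almost
   everywhere and in mean. *)
Definition is_bochner_integral (V : normedModType (scalars k R)) (f : T -> V)
    (I : V) : Prop :=
  exists l : nat -> seq (set T * V),
    [/\ forall n p, p \in l n -> measurable p.1 /\ (mu p.1 < +oo)%E,
        {ae mu, forall z, (fun n => simple_fun (l n) z) @ \oo --> f z},
        (fun n => \int[mu]_z (hnorm (f z - simple_fun (l n) z))%:E)%E @ \oo -->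
          (0 : \bar R)%E
      & (fun n => simple_integral (l n)) @ \oo --> I].

End integrals.

Section rkhs.
Variables (k : scalar_kind) (R : realType) (V Y : hilbertType k R).
Variables (Omega : Type) (Rs : Omega -> V -> Y).

Definition feature_fun (v : V) : Omega -> Y := fun w => Rs w v.

(* The norm |f_v|_H := |v|_V, as a function of f_v: the representer v is unique
   as soon as feature_fun is injective. *)
Definition rkhs_norm (f : Omega -> Y) : R :=
  hnorm (xget 0 [set v : V | feature_fun v = f]).

End rkhs.

(* The samples have indices 0, ..., n if N = Some n and 0, 1, 2, ... if N = None. *)
Definition in_horizon (N : option nat) (m : nat) : Prop :=
  if N is Some n then (m <= n)%N else True.

Section sampling.
Variable R : realType.
Context (d : measure_display) (T : measurableType d).
Context (d' : measure_display) (S : measurableType d').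

Definition mutually_independent (P : probability T R) (I : set nat)
    (X : nat -> T -> S) : Prop :=
  forall (s : seq nat) (A : nat -> set S), uniq s ->
    (forall i, i \in s -> I i /\ measurable (A i)) ->
    (P (\bigcap_(i in [set` s]) (X i @^-1` A i)) =
     \prod_(i <- s) P (X i @^-1` A i))%E.

Definition iid_samples (P : probability T R) (mu : probability S R)
    (I : set nat) (X : nat -> T -> S) : Prop :=
  [/\ forall i, I i -> measurable_fun setT (X i),
      forall i, I i -> forall A, measurable A -> P (X i @^-1` A) = mu A
    & mutually_independent P I X].

End sampling.

Section online_iteration.
Variables (k : scalar_kind) (R : realType) (V Y : hilbertType k R).
Variables (Omega : Type) (Rop : Omega -> Y -> V) (Rs : Omega -> V -> Y).

Fixpoint online_iterate (A t : R) (u0 : V) (z : nat -> Omega * Y) (m : nat) : V :=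
  if m is m'.+1 then
    let um := online_iterate A t u0 z m' in
    let alpha : R := m'.+1%:R / m'.+2%:R in
    let step : R := A / m'.+1%:R `^ t in
    of_real k alpha *:
      (um + of_real k step *: Rop (z m').1 ((z m').2 - Rs (z m').1 um))
  else u0.

End online_iteration.

(* Main.v *)
(* Write e = u - v and let eps = y - R^* u be the noise, for which
   E(R eps) = 0.  For a fixed iterate v the expected squared error after one step is
   a quadratic expression in u and e in which the step size produces the negative
   term - (P e, e).  The term (u, e) created by the damping factors alpha_m is
   bounded, mode by mode in the eigenbasis of P, by a combination of (P e, e),
   |e|^2 and |u|_s^2 with a regularization parameter kappa: one uses
   lambda^s <= s kappa^(s-1) lambda + (1-s) kappa^s.  With n = m + 1,
   nu = n^(1/(2+s)) and kappa = Lambda / nu this gives a scalar recursion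
   (n+1)^2 E_(m+1) <= (n^2 + n (1-s)/2) E_m + nu^2 B, which
   propagates E_m <= C^2 nu^2 / n by Bernoulli's inequality.
   That the sample used in step m is independent of the iterate is exploited by
   approximating the iterate with functions having countably many values and
   passing to the limit with Fatou's lemma. *)
Require Import Defs.
From HB Require Import structures.
From mathcomp Require Import all_boot all_order all_algebra complex.
From mathcomp Require Import all_classical all_reals all_analysis.
From mathcomp Require Import measurable_realfun ring lra.

Set Implicit Arguments.
Unset Strict Implicit.
Unset Printing Implicit Defensive.

Import Order.TTheory GRing.Theory Num.Theory.
Import numFieldNormedType.Exports.

Local Open Scope classical_set_scope.
Local Open Scope ring_scope.

(** * Hilbert spaces over the reals or the complex numbers *)

Section Scalars.
Context {k : scalar_kind} {R : realType}.
Implicit Types (x y : scalars k R) (a : R).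

Lemma sreD x y : sre (x + y) = sre x + sre y.
Proof. by case: k x y => [|[? ?] [? ?]]. Qed.

Lemma sre0 : sre (0 : scalars k R) = 0.
Proof. by case: k. Qed.

Lemma sreN x : sre (- x) = - sre x.
Proof. by case: k x => [|[? ?]]. Qed.

Lemma sre_sum I (r : seq I) (Q : pred I) (F : I -> scalars k R) :
  sre (\sum_(i <- r | Q i) F i) = \sum_(i <- r | Q i) sre (F i).
Proof. exact: (big_morph _ sreD sre0). Qed.

Lemma sre_of_realM a x : sre (of_real k a * x) = a * sre x.
Proof. by rewrite /of_real /smk; case: k x => [|[? ?]] //=; rewrite mul0r subr0. Qed.

Lemma sre_of_real a : sre (of_real k a) = a.
Proof. by rewrite /of_real /smk; case: k. Qed.

Lemma sre_smk a b : sre (smk k a b) = a.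
Proof. by rewrite /smk; case: k. Qed.

Lemma sre_conj x : sre (sconj x) = sre x.
Proof. by case: k x => [|[? ?]]. Qed.

Lemma of_realM a b : of_real k (a * b) = of_real k a * of_real k b.
Proof.
rewrite /of_real /smk; case: k => //=.
by apply/eqP; rewrite eq_complex /=; apply/andP; split; apply/eqP; ring.
Qed.

Lemma of_realD a b : of_real k (a + b) = of_real k a + of_real k b.
Proof.
rewrite /of_real /smk; case: k => //=.
by apply/eqP; rewrite eq_complex /= addr0 !eqxx.
Qed.

Lemma of_real1 : of_real k (1 : R) = 1.
Proof. by rewrite /of_real /smk; case: k. Qed.

Lemma of_real_norm x : `|x| = of_real k (sre `|x|).
Proof. by rewrite /of_real /smk; case: k x. Qed.

Lemma sre_le x y : x <= y -> sre x <= sre y.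
Proof. by case: k x y => [|[? ?] [? ?]] //=; rewrite lecE /= => /andP[]. Qed.

Lemma sre_lt x y : x < y -> sre x < sre y.
Proof. by case: k x y => [|[? ?] [? ?]] //=; rewrite ltcE /= => /andP[]. Qed.

Lemma of_real_lt a b : a < b -> of_real k a < of_real k b.
Proof. by rewrite /of_real /smk; case: k => //=; rewrite ltcE /= eqxx. Qed.

Lemma sre_norm_of_real a : sre `|of_real k a| = `|a|.
Proof.
rewrite /of_real /smk; case: k => //=.
by rewrite expr0n /= addr0 sqrtr_sqr.
Qed.

Lemma sre_conjM x : sre (sconj x * x) = sre `|x| ^+ 2.
Proof.
case: k x => [x|[x1 x2]] /=; first by rewrite real_normK ?num_real.
by rewrite sqr_sqrtr ?addr_ge0 ?sqr_ge0//; ring.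
Qed.

Lemma sre_norm_ge x : `|sre x| <= sre `|x|.
Proof.
case: k x => [x|[x1 x2]] //=.
by rewrite -sqrtr_sqr ler_wsqrtr// lerDl sqr_ge0.
Qed.

Lemma sre_normM x y : sre `|x * y| = sre `|x| * sre `|y|.
Proof. by rewrite normrM [in LHS](of_real_norm x) sre_of_realM. Qed.

Lemma norm_sconj x : `|sconj x| = `|x|.
Proof. by case: k x => [x|[x1 x2]] //; rewrite !normc_def /= sqrrN. Qed.

End Scalars.

Section HilbertSpace.
Context {k : scalar_kind} {R : realType}.

Section Normed.
Context {V : normedModType (scalars k R)}.
Implicit Types x y : V.

Lemma hnorm_ge0 x : 0 <= hnorm x.
Proof. by rewrite /hnorm -(@sre0 k) sre_le. Qed.

Lemma hnorm0 : hnorm (0 : V) = 0.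
Proof. by rewrite /hnorm normr0 sre0. Qed.

Lemma norm_hnorm x : `|x| = of_real k (hnorm x).
Proof. by rewrite /hnorm -[LHS]normr_id of_real_norm normr_id. Qed.

Lemma hnorm_eq0 x : hnorm x = 0 -> x = 0.
Proof.
move=> x0; apply/normr0_eq0; rewrite norm_hnorm x0.
by rewrite /of_real /smk; case: k.
Qed.

Lemma hnormD x y : hnorm (x + y) <= hnorm x + hnorm y.
Proof. by rewrite /hnorm -sreD sre_le// ler_normD. Qed.

Lemma hnormN x : hnorm (- x) = hnorm x.
Proof. by rewrite /hnorm normrN. Qed.

Lemma hnorm_dist x y : `|hnorm x - hnorm y| <= hnorm (x - y).
Proof.
have hx : hnorm x <= hnorm (x - y) + hnorm y by rewrite -{1}[x](subrK y) hnormD.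
have hy : hnorm y <= hnorm (x - y) + hnorm x.
  by rewrite -{1}[y](subrK x) -(hnormN (x - y)) opprB hnormD.
by rewrite ler_norml; apply/andP; split; lra.
Qed.

Lemma hnorm_scale (c : scalars k R) x : hnorm (c *: x) = sre `|c| * hnorm x.
Proof. by rewrite /hnorm normrZ (of_real_norm c) sre_of_realM sre_of_real. Qed.

Lemma hnormZ (a : R) x : hnorm (of_real k a *: x) = `|a| * hnorm x.
Proof. by rewrite hnorm_scale sre_norm_of_real. Qed.

Lemma nbhs_hnorm x (e : R) : 0 < e -> nbhs x [set y | hnorm (x - y) < e].
Proof.
move=> e0; apply/nbhs_ballP; exists (of_real k e).
  by rewrite /= -[0](_ : of_real k 0 = _) ?of_real_lt// /of_real /smk; case: k.
by move=> y; rewrite -ball_normE /= => /sre_lt; rewrite sre_of_real.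
Qed.

Lemma dense_hnorm (D : set V) x (e : R) : dense D -> 0 < e ->
  exists2 y, D y & hnorm (x - y) < e.
Proof.
move=> dD e0.
have []:= dD (interior [set y | hnorm (x - y) < e]).
- by exists x; exact: nbhs_hnorm.
- exact: open_interior.
- by move=> y [/interior_subset xy Dy]; exists y.
Qed.

End Normed.

(** The real part of the inner product is itself a real inner product with the same norm. Working
    with it treats both scalar fields at once and keeps every estimate in [R]. *)
Definition ip {V : hilbertType k R} (x y : V) : R := sre (inner x y).

Section Inner.
Context {V : hilbertType k R}.
Implicit Types x y z : V.

Lemma ipC x y : ip x y = ip y x.
Proof. by rewrite /ip inner_conjC sre_conj. Qed.

Lemma innerDl x y z : inner (x + y) z = inner x z + inner y z.
Proof. by have := inner_linearl 1 x y z; rewrite scale1r mul1r. Qed.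

Lemma inner0l z : inner (0 : V) z = 0.
Proof. by apply: (addrI (inner 0 z)); rewrite -innerDl !addr0. Qed.

Lemma innerZl c x z : inner (c *: x) z = c * inner x z.
Proof. by rewrite -[_ *: _]addr0 inner_linearl inner0l addr0. Qed.

Lemma ipDl x y z : ip (x + y) z = ip x z + ip y z.
Proof. by rewrite /ip innerDl sreD. Qed.

Lemma ipDr x y z : ip z (x + y) = ip z x + ip z y.
Proof. by rewrite ipC ipDl ![ip _ z]ipC. Qed.

Lemma ip0l z : ip (0 : V) z = 0.
Proof. by rewrite /ip inner0l sre0. Qed.

Lemma ip0r z : ip z (0 : V) = 0.
Proof. by rewrite ipC ip0l. Qed.

Lemma ipZl (a : R) x z : ip (of_real k a *: x) z = a * ip x z.
Proof. by rewrite /ip innerZl sre_of_realM. Qed.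

Lemma ipZr (a : R) x z : ip z (of_real k a *: x) = a * ip z x.
Proof. by rewrite ipC ipZl ipC. Qed.

Lemma ipNl x z : ip (- x) z = - ip x z.
Proof. by apply: (addrI (ip x z)); rewrite -ipDl !subrr ip0l. Qed.

Lemma ipNr x z : ip z (- x) = - ip z x.
Proof. by rewrite ipC ipNl ipC. Qed.

Definition ipE := (ipDl, ipDr, ipNl, ipNr, ipZl, ipZr).

Lemma hnorm2E x : hnorm x ^+ 2 = ip x x.
Proof. by rewrite /ip inner_normE norm_hnorm !expr2 sre_of_realM sre_of_real. Qed.

Lemma ipxx_ge0 x : 0 <= ip x x.
Proof. by rewrite -hnorm2E sqr_ge0. Qed.

Lemma ip_sum I (r : seq I) (Q : pred I) (F : I -> V) x :
  ip x (\sum_(i <- r | Q i) F i) = \sum_(i <- r | Q i) ip x (F i).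
Proof. exact: (big_morph _ (fun a b => ipDr a b x) (ip0r x)). Qed.

Lemma inner_suml I (r : seq I) (Q : pred I) (F : I -> V) x :
  inner (\sum_(i <- r | Q i) F i) x = \sum_(i <- r | Q i) inner (F i) x.
Proof. exact: (big_morph _ (fun a b => innerDl a b x) (inner0l x)). Qed.

Lemma ip_cauchy_schwarz x y : `|ip x y| <= hnorm x * hnorm y.
Proof.
have [y0|y0] := eqVneq (hnorm y) 0.
  by rewrite (hnorm_eq0 y0) ip0r hnorm0 mulr0 normr0.
have y2 : 0 < hnorm y ^+ 2 by rewrite exprn_gt0// lt_neqAle eq_sym y0 hnorm_ge0.
rewrite -ler_sqr ?nnegrE ?mulr_ge0 ?hnorm_ge0// real_normK ?num_real// exprMn.
(* The squared norm of |y|^2 x - (x,y) y equals |y|^2 (|x|^2 |y|^2 - (x,y)^2). *)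
have := ipxx_ge0 (of_real k (hnorm y ^+ 2) *: x + of_real k (- ip x y) *: y).
rewrite !ipE (ipC y x) -!hnorm2E => H.
rewrite -subr_ge0 -(pmulr_rge0 _ y2).
by apply: le_trans H _; rewrite le_eqVlt; apply/orP; left; apply/eqP; ring.
Qed.

Lemma ip2_cauchy_schwarz x y : ip x y ^+ 2 <= hnorm x ^+ 2 * hnorm y ^+ 2.
Proof.
rewrite -exprMn -[leLHS]real_normK ?num_real// ler_sqr ?nnegrE ?mulr_ge0 ?hnorm_ge0//.
exact: ip_cauchy_schwarz.
Qed.

Lemma ip_ext x y : (forall z, ip x z = ip y z) -> x = y.
Proof.
move=> xy; apply/subr0_eq/hnorm_eq0/eqP; rewrite -sqrf_eq0 hnorm2E.
by rewrite ipDl ipNl xy subrr.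
Qed.

End Inner.
End HilbertSpace.

(** * Bounded operators and adjoints *)

Section BoundedOperators.
Context {k : scalar_kind} {R : realType}.

(** Continuity makes the set under the supremum bounded, so [sup] does not take its default value 0.
    The bound is then read off at x/|x|. *)
Lemma le_opnorm (V W : normedModType (scalars k R)) (T : {linear V -> W}) x :
  continuous T -> hnorm (T x) <= opnorm T * hnorm x.
Proof.
move=> /linear_bounded_continuous/linear_boundedP/pinfty_ex_gt0[r r0 Tr].
have Tle y : hnorm (T y) <= sre r * hnorm y.
  have := sre_le (Tr y).
  by rewrite [`|y|]norm_hnorm mulrC sre_of_realM mulrC.
have r0' : 0 <= sre r by rewrite -(@sre0 k) sre_le// ltW.
have [x0|x0] := eqVneq (hnorm x) 0.
  by rewrite (hnorm_eq0 x0) linear0 !hnorm0 mulr0.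
have {}x0 : 0 < hnorm x by rewrite lt_neqAle eq_sym x0 hnorm_ge0.
rewrite -ler_pdivrMr//.
apply: ub_le_sup.
  exists (sre r) => _ [y /= y1 <-].
  by rewrite (le_trans (Tle y))// ler_piMr.
exists (of_real k (hnorm x)^-1 *: x) => /=.
  by rewrite hnormZ ger0_norm ?invr_ge0 ?hnorm_ge0// mulVf ?gt_eqF.
by rewrite linearZ /= hnormZ ger0_norm ?invr_ge0 ?hnorm_ge0// mulrC.
Qed.

Context {Y V : hilbertType k R} (T : {linear Y -> V}) (T' : V -> Y) (L : R).
Hypotheses (Tcont : continuous T) (TT' : is_adjoint T T').
Hypothesis TL : opnorm T ^+ 2 <= L.

Lemma ip_adjoint x y : ip (T x) y = ip x (T' y).
Proof. by rewrite /ip TT'. Qed.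

(** [T'] is given only as a function; additivity follows from the adjoint relation because vectors
    are separated by their pairings. *)
Lemma adjointD x y : T' (x + y) = T' x + T' y.
Proof. by apply: ip_ext => z; rewrite ipDl ![ip _ z]ipC -!ip_adjoint ipDr. Qed.

Lemma adjointN x : T' (- x) = - T' x.
Proof. by apply: ip_ext => z; rewrite ipNl ![ip _ z]ipC -!ip_adjoint ipNr. Qed.

Lemma hnorm2_op x : hnorm (T x) ^+ 2 <= L * hnorm x ^+ 2.
Proof.
apply: (@le_trans _ _ (opnorm T ^+ 2 * hnorm x ^+ 2)); last first.
  by rewrite ler_wpM2r// sqr_ge0.
rewrite -exprMn ler_sqr ?nnegrE ?hnorm_ge0//; first exact: le_opnorm.
exact: le_trans (hnorm_ge0 _) (le_opnorm _ Tcont).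
Qed.

(** By Cauchy-Schwarz, |T' v|^4 = (T (T' v), v)^2 <= L |T' v|^2 |v|^2, and one divides by |T'
    v|^2. *)
Lemma hnorm2_adjoint v : hnorm (T' v) ^+ 2 <= L * hnorm v ^+ 2.
Proof.
have [->|v0] := eqVneq (hnorm (T' v)) 0.
  by rewrite expr0n mulr_ge0 ?sqr_ge0//; exact: le_trans (sqr_ge0 _) TL.
have v2 : 0 < hnorm (T' v) ^+ 2.
  by rewrite exprn_gt0// lt_neqAle eq_sym v0 hnorm_ge0.
rewrite -(ler_pM2r v2) -expr2 {1}hnorm2E -ip_adjoint.
apply: le_trans (ip2_cauchy_schwarz _ _) _.
by rewrite [leRHS]mulrAC ler_wpM2r ?sqr_ge0// hnorm2_op.
Qed.

End BoundedOperators.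

(** * Weak measurability *)

Section Measurability.
Context {R : realType}.

Lemma continuous_borel_measurable (T : ptopologicalType) (f : T -> R) :
  continuous f -> measurable_fun [set: borel T] (f : borel T -> R).
Proof.
move=> cf; apply: (measurability _ (RGenOpens.measurableE R)).
move=> _ [_ [a [b ->]] <-]; rewrite setTI.
by apply: sub_sigma_algebra; apply: open_comp => //= x _; exact: cf.
Qed.

Lemma continuous_borel_borel (T U : ptopologicalType) (f : T -> U) :
  continuous f -> measurable_fun [set: borel T] (f : borel T -> borel U).
Proof.
move=> cf; apply: (@measurability _ _ (borel T) (borel U) _ _ (@open U) erefl).
move=> _ [B oB <-]; rewrite setTI.
by apply: sub_sigma_algebra; apply: open_comp => //= x _; exact: cf.
Qed.

Lemma measurable_fun_supercut d (T : measurableType d) (f : T -> R) :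
  (forall a, measurable [set x | a < f x]) -> measurable_fun [set: T] f.
Proof.
move=> mf; apply: (measurability _ (RGenOInfty.measurableE R)).
move=> _ [_ [a ->] <-]; rewrite setTI.
by rewrite [X in measurable X](_ : _ = [set x | a < f x])//; apply/seteqP; split=> x /=;
  rewrite in_itv/= andbT.
Qed.

Lemma measurable_superlevel d (T : measurableType d) (f : T -> R) a :
  measurable_fun setT f -> measurable [set x | a < f x].
Proof.
move=> /(_ measurableT _ (measurable_itv `]a, +oo[)); rewrite setTI.
by congr measurable; apply/seteqP; split=> x /=; rewrite in_itv/= andbT.
Qed.

Context {k : scalar_kind}.

Lemma continuous_sre : continuous (@sre k R).
Proof.
move=> x.
apply/(cvgrPdist_lt (FF := nbhs_filter (x : scalars k R))) => e e0.
have e0' : 0 < of_real k e.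
  by rewrite -[0](_ : of_real k 0 = _) ?of_real_lt// /of_real /smk; case: k.
apply/nbhs_ballP; exists (of_real k e) => //= y.
rewrite -ball_normE /= => /sre_lt; rewrite sre_of_real; apply: le_lt_trans.
by rewrite -sreN -sreD sre_norm_ge.
Qed.

Section Weak.
Context {V : hilbertType k R}.

Lemma separable_seq : separable V ->
  exists e : nat -> V, forall x (eps : R), 0 < eps -> exists n, hnorm (x - e n) < eps.
Proof.
move=> [D /countable_injP[f finj] dD].
(* The injection [f] is inverted. Numbers outside its image get the default 0, which is harmless
   since only indices [f y] with [y] in [D] serve as witnesses. *)
exists (fun n => xget 0 [set v | D v /\ f v = n]) => x eps eps0.
have [y Dy xy] := dense_hnorm x dD eps0.
exists (f y); case: xgetP => [z _ [Dz fzy]|noy].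
  by rewrite (finj z y) ?inE.
by case: (noy y).
Qed.

Lemma continuous_ip (w : V) : continuous (ip^~ w : V -> R).
Proof.
have w0 : 0 < hnorm w + 1 by rewrite ltr_pwDr// hnorm_ge0.
move=> x; apply/cvgrPdist_lt => e e0; near=> y.
rewrite -ipNl -ipDl; apply: le_lt_trans (ip_cauchy_schwarz _ _) _.
apply: (@le_lt_trans _ _ (hnorm (x - y) * (hnorm w + 1))).
  by rewrite ler_wpM2l ?hnorm_ge0// lerDl.
rewrite -ltr_pdivlMr//; near: y; apply: nbhs_hnorm; exact: divr_gt0.
Unshelve. all: by end_near.
Qed.

Context {d : measure_display} {T : measurableType d}.

(** Real pairings suffice over both fields, the imaginary part being a real pairing with a rotated
    vector. Separability turns this into measurability of norms and of pairings of two such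
    functions. *)
Definition weakly_measurable (f : T -> V) :=
  forall w, measurable_fun setT (fun x => ip (f x) w).

Lemma weakly_measurable_cst v : weakly_measurable (cst v).
Proof. by move=> w; exact: (measurable_cst (ip v w)). Qed.

Lemma weakly_measurableD f g : weakly_measurable f -> weakly_measurable g ->
  weakly_measurable (fun x => f x + g x).
Proof.
move=> mf mg w; under eq_fun do rewrite ipDl.
by apply: measurable_funD; [exact: mf|exact: mg].
Qed.

Lemma weakly_measurableZ (a : R) f : weakly_measurable f ->
  weakly_measurable (fun x => of_real k a *: f x).
Proof.
move=> mf w; under eq_fun do rewrite ipZl.
by apply: measurable_funM; [exact: measurable_cst|exact: mf].
Qed.

Lemma weakly_measurableN f : weakly_measurable f ->
  weakly_measurable (fun x => - f x).
Proof.
move=> mf w; under eq_fun do rewrite ipNl.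
by apply: measurableT_comp => //; exact: mf.
Qed.

Lemma weakly_measurableB f g : weakly_measurable f -> weakly_measurable g ->
  weakly_measurable (fun x => f x - g x).
Proof. by move=> mf mg; apply: weakly_measurableD => //; exact: weakly_measurableN. Qed.

Hypothesis Vsep : separable V.

(* ||x||^2 is the supremum of 2 (x, e_n) - ||e_n||^2 over a dense sequence e. *)
Lemma measurable_hnorm2 f : weakly_measurable f ->
  measurable_fun setT (fun x => hnorm (f x) ^+ 2).
Proof.
move=> mf; have [e edense] := separable_seq Vsep.
apply: measurable_fun_supercut => a.
rewrite [X in measurable X](_ : _ =
    \bigcup_n [set x | a < 2 * ip (f x) (e n) - hnorm (e n) ^+ 2]).
  apply: bigcup_measurable => n _.
  apply: measurable_superlevel.
  apply: measurable_funB; last exact: measurable_cst.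
  apply: measurable_funM; first exact: measurable_cst.
  exact: mf.
apply/seteqP; split => [x /= ax|x [n _ /=]].
  have [n xn] := edense (f x) (Num.sqrt (hnorm (f x) ^+ 2 - a)) ltac:(by rewrite sqrtr_gt0 subr_gt0).
  exists n => //=.
  have := xn; rewrite -ltr_sqr ?nnegrE ?hnorm_ge0 ?sqrtr_ge0// sqr_sqrtr ?subr_ge0 1?ltW//.
  rewrite !hnorm2E !ipE (ipC (e n) (f x)); lra.
move/lt_le_trans; apply.
by have := ipxx_ge0 (f x - e n); rewrite !hnorm2E !ipE (ipC (e n) (f x)); lra.
Qed.

(** Polarization reduces the pairing to three squared norms. *)
Lemma measurable_ip f g : weakly_measurable f -> weakly_measurable g ->
  measurable_fun setT (fun x => ip (f x) (g x)).
Proof.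
move=> mf mg.
rewrite (_ : (fun x => _) = fun x => 2^-1 * (hnorm (f x + g x) ^+ 2 - hnorm (f x) ^+ 2 - hnorm (g x) ^+ 2)).
  apply: measurable_funM; first exact: measurable_cst.
  by do !apply: measurable_funB; apply: measurable_hnorm2 => //; exact: weakly_measurableD.
by apply/funext => x; rewrite !hnorm2E !ipE (ipC (g x) (f x)); field.
Qed.

Lemma measurable_hnorm f : weakly_measurable f ->
  measurable_fun setT (fun x => hnorm (f x)).
Proof.
move=> /measurable_hnorm2 mf.
have hE x : hnorm (f x) = (hnorm (f x) ^+ 2) `^ 2^-1.
  by rewrite powR12_sqrt ?sqr_ge0// sqrtr_sqr ger0_norm ?hnorm_ge0.
by under eq_fun do rewrite hE; exact: measurableT_comp (measurable_powR _) mf.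
Qed.

End Weak.
End Measurability.

(** * Smoothness and the spectral decomposition *)

Section PowerInequalities.
Context {R : realType}.
Implicit Types x y s q : R.

(** Young's inequality for the product of x^s and 1, with exponents 1/s and 1/(1-s). The case s = 1,
    where the second exponent degenerates, is an equality. *)
Lemma powR_le_affine s x : 0 < s <= 1 -> 0 <= x -> x `^ s <= s * x + (1 - s).
Proof.
move=> /andP[s0 s1] x0; have [->|s1'] := eqVneq s 1.
  by rewrite powRr1// mul1r subrr addr0.
have {}s1 : s < 1 by rewrite lt_neqAle s1'.
have q0 : 0 < (1 - s)^-1 by rewrite invr_gt0 subr_gt0.
have s0' : 0 < s^-1 by rewrite invr_gt0.
have := conjugate_powR (powR_ge0 x s) ler01 s0' q0.
rewrite !invrK addrC subrK => /(_ erefl).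
rewrite -powRrM mulfV ?gt_eqF// powRr1// mulr1 powR1 mul1r.
by rewrite [x * s]mulrC.
Qed.

(** A concave power lies below its tangent at y; scaling by y reduces this to the tangent at 1. *)
Lemma powR_le_tangent s x y : 0 < s <= 1 -> 0 <= x -> 0 < y ->
  x `^ s <= s * y `^ (s - 1) * x + (1 - s) * y `^ s.
Proof.
move=> s01 x0 y0; have y0' := ltW y0.
have -> : x = y * (x / y) by rewrite mulrC divfK ?gt_eqF.
have xy0 : 0 <= x / y by exact: divr_ge0.
have ys : 0 <= y `^ s by exact: powR_ge0.
rewrite powRM//; apply: le_trans (ler_wpM2l ys (powR_le_affine s01 xy0)) _.
have -> : y `^ (s - 1) = y `^ s / y by rewrite powRB ?powRr1// (gt_eqF y0) implybT.
by rewrite le_eqVlt; apply/orP; left; apply/eqP; field; rewrite gt_eqF.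
Qed.

(** This is the concave inequality [powR_le_affine] with exponent 1/q, applied to x^q and multiplied
    by q. *)
Lemma bernoulli_powR q x : 1 <= q -> 0 <= x -> 1 + q * (x - 1) <= x `^ q.
Proof.
move=> q1 x0; have q0 : 0 < q by exact: lt_le_trans q1.
have s01 : 0 < q^-1 <= 1 by rewrite invr_gt0 q0 invf_le1.
have := powR_le_affine s01 (powR_ge0 x q).
rewrite -powRrM mulfV ?gt_eqF// powRr1// -(ler_pM2l q0) mulrDr mulrA mulfV ?gt_eqF//.
rewrite mulrBr mulfV ?gt_eqF//; lra.
Qed.

End PowerInequalities.

(** * Partial sums in the eigenbasis and the smoothness estimate *)

Section Spectral.
Context {k : scalar_kind} {R : realType} {V : hilbertType k R}.
Variables (psi : nat -> V).
Hypothesis psi_on : forall i j : nat, inner (psi i) (psi j) = (i == j)%:R.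
Implicit Types (v w : V) (n : nat).

(** The orthogonal projection of [v] onto the span of the first [n] basis vectors. *)
Definition partial_sum n v : V := \sum_(i < n) inner v (psi i) *: psi i.

Lemma inner_comb n (c : nat -> scalars k R) j : (j < n)%N ->
  inner (\sum_(i < n) c i *: psi i) (psi j) = c j.
Proof.
move=> jn; rewrite inner_suml (bigD1 (Ordinal jn)) //= innerZl psi_on eqxx mulr1.
rewrite big1 ?addr0// => i ij; rewrite innerZl psi_on.
rewrite (_ : (_ == _) = false) ?mulr0//; apply/negbTE.
by move: ij; rewrite -val_eqE.
Qed.

Lemma ip_comb n (c : nat -> scalars k R) v :
  ip (\sum_(i < n) c i *: psi i) v = \sum_(i < n) sre (c i * sconj (inner v (psi i))).
Proof.
by rewrite /ip inner_suml sre_sum; apply: eq_bigr => i _; rewrite innerZl (inner_conjC v).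
Qed.

Lemma ip_residual n v (c : nat -> scalars k R) :
  ip (v - partial_sum n v) (\sum_(i < n) c i *: psi i) = 0.
Proof.
rewrite ipC ip_comb big1// => i _.
rewrite innerDl -scaleN1r innerZl (inner_comb (fun j => inner v (psi j)))// mulN1r subrr.
by have -> : sconj (0 : scalars k R) = 0; [rewrite /sconj; case: k => //=; rewrite oppr0|rewrite mulr0 sre0].
Qed.

Lemma ip_partial_sum n v : ip (partial_sum n v) v = \sum_(i < n) sre `|inner v (psi i)| ^+ 2.
Proof.
rewrite (ip_comb _ (fun i => inner v (psi i))).
by apply: eq_bigr => i _; rewrite mulrC sre_conjM.
Qed.

Lemma bessel n v : \sum_(i < n) sre `|inner v (psi i)| ^+ 2 <= hnorm v ^+ 2.
Proof.
have := ip_residual n v (fun i => inner v (psi i)); rewrite -/(partial_sum n v).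
have := ipxx_ge0 (v - partial_sum n v).
rewrite -ip_partial_sum hnorm2E !ipE (ipC v); lra.
Qed.

(** Pythagoras: the residual is orthogonal to the difference between the partial sum and any other
    combination. *)
Lemma partial_sum_best n v (c : nat -> scalars k R) :
  hnorm (v - partial_sum n v) <= hnorm (v - \sum_(i < n) c i *: psi i).
Proof.
rewrite -ler_sqr ?nnegrE ?hnorm_ge0// !hnorm2E.
set r := v - _; set b := partial_sum n v - \sum_(i < n) c i *: psi i.
have -> : v - \sum_(i < n) c i *: psi i = r + b by rewrite /r /b addrA subrK.
have rb : ip r b = 0 by rewrite /b ipDr ipNr (ip_residual _ _ (fun i => inner v (psi i))) ip_residual subrr.
by move: rb (ipxx_ge0 b); clearbody r b => rb b0; rewrite !ipE (ipC b r) rb; lra.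
Qed.

Variables (P : {linear V -> V}) (lambda : nat -> R).
Hypothesis Psym : forall v w, ip (P v) w = ip (P w) v.
Hypothesis Ppos : forall v, 0 <= ip (P v) v.
Hypothesis Peigen : forall i, P (psi i) = of_real k (lambda i) *: psi i.

(** Bessel's inequality for the form (P v, v). As [P S] stays in the span, it is orthogonal to v -
    S, so (P v, v) = (P S, v) + (P (v - S), v - S), where the last term is nonnegative. *)
Lemma operator_bessel n v :
  \sum_(i < n) lambda i * sre `|inner v (psi i)| ^+ 2 <= ip (P v) v.
Proof.
set S := partial_sum n v.
have PS : P S = \sum_(i < n) (inner v (psi i) * of_real k (lambda i)) *: psi i.
  rewrite /S /partial_sum linear_sum; apply: eq_bigr => i _.
  by rewrite linearZ /= Peigen scalerA.
have PSr : ip (P S) (v - S) = 0.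
  by rewrite PS ipC (ip_residual _ _ (fun i => inner v (psi i) * of_real k (lambda i))).
have PSv : ip (P S) v = \sum_(i < n) lambda i * sre `|inner v (psi i)| ^+ 2.
  rewrite PS (ip_comb _ (fun i => inner v (psi i) * of_real k (lambda i))).
  apply: eq_bigr => i _.
  by rewrite mulrAC [X in sre X]mulrC sre_of_realM mulrC [X in sre X]mulrC sre_conjM mulrC.
rewrite -PSv.
have := Ppos (v - S); rewrite linearB !ipE (Psym v S).
move: PSr; rewrite !ipE; lra.
Qed.

Hypothesis psi_dense : dense [set v : V | exists (n : nat) (c : nat -> scalars k R),
                       v = \sum_(i < n) c i *: psi i].
Hypothesis lambda_gt0 : forall i, 0 < lambda i.
Variables (s : R).
Hypothesis s01 : 0 < s <= 1.

(** Each mode is split by a weighted arithmetic-geometric mean inequality with weight theta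
    lambda^s; the tangent at kappa then replaces lambda^s by an affine function of lambda, whose two
    terms are summed by the two Bessel inequalities. *)
Lemma ip_smoothness (u e : V) (U theta kappa : R) : 0 < theta -> 0 < kappa ->
  (forall n, \sum_(i < n) lambda i `^ (- s) * sre `|inner u (psi i)| ^+ 2 <= U) ->
  2 * ip u e <= theta * (s * kappa `^ (s - 1) * ip (P e) e + (1 - s) * kappa `^ s * hnorm e ^+ 2)
     + U / theta.
Proof.
move=> t0 k0 uU; set B := leRHS.
have partial n : 2 * ip (partial_sum n u) e <= B.
  rewrite (ip_comb _ (fun i => inner u (psi i))).
  apply: (@le_trans _ _ (\sum_(i < n)
     (theta * (s * kappa `^ (s - 1) * (lambda i * sre `|inner e (psi i)| ^+ 2)
               + (1 - s) * kappa `^ s * sre `|inner e (psi i)| ^+ 2)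
       + theta^-1 * (lambda i `^ (- s) * sre `|inner u (psi i)| ^+ 2)))).
    rewrite mulr_sumr; apply: ler_sum => i _.
    set c := inner u _; set d := inner e _.
    have cd : sre (c * sconj d) <= sre `|c| * sre `|d|.
      by rewrite -(norm_sconj d) -sre_normM (le_trans (ler_norm _))// sre_norm_ge.
    have := powR_le_tangent s01 (ltW (lambda_gt0 i)) k0.
    have l0 : 0 < lambda i `^ s by rewrite powR_gt0.
    rewrite powRN; set l := lambda i `^ s in l0 *.
    move=> /(ler_wpM2r (sqr_ge0 (sre `|d|))) /(ler_wpM2l (ltW t0)).
    set rhs := (X in _ <= X) => Hl.
    (* The difference of the two sides is (theta l |d| - |c|)^2 / (theta l). *)
    have AMGM : 2 * (sre `|c| * sre `|d|) <=
        theta * (l * sre `|d| ^+ 2) + theta^-1 * (l^-1 * sre `|c| ^+ 2).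
      rewrite -subr_ge0.
      have -> : theta * (l * sre `|d| ^+ 2) + theta^-1 * (l^-1 * sre `|c| ^+ 2)
           - 2 * (sre `|c| * sre `|d|)
         = (theta * l)^-1 * (theta * l * sre `|d| - sre `|c|) ^+ 2.
        by field; rewrite !gt_eqF.
      by rewrite mulr_ge0 ?sqr_ge0// invr_ge0 ltW// mulr_gt0.
    move: Hl AMGM cd; rewrite /rhs; lra.
  rewrite big_split /= -!mulr_sumr big_split /= -!mulr_sumr /B.
  have [s0 s1] := andP s01.
  rewrite lerD//; last by rewrite [leRHS]mulrC ler_wpM2l ?invr_ge0 ?(ltW t0)// uU.
  rewrite ler_wpM2l ?(ltW t0)// lerD// ler_wpM2l ?mulr_ge0 ?powR_ge0 ?subr_ge0 ?(ltW s0)//.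
  - exact: operator_bessel.
  - exact: bessel.
(* Passage from partial sums to [u]: density and best approximation give an index with 2 |u - S_n u|
   (|e| + 1) <= eps. The added 1 covers e = 0. *)
apply/ler_addgt0Pr => eps eps0.
have he : 0 < 2 * (hnorm e + 1) by rewrite mulr_gt0// ltr_pwDr// hnorm_ge0.
have [_ [n [c ->]] uc] := dense_hnorm u psi_dense (divr_gt0 eps0 he).
have := partial n; have := ip_cauchy_schwarz (u - partial_sum n u) e.
rewrite ipDl ipNl => /(le_trans (ler_norm _)).
have : hnorm (u - partial_sum n u) * (2 * (hnorm e + 1)) <= eps.
  rewrite -ler_pdivlMr//; exact: le_trans (partial_sum_best _ _ _) (ltW uc).
have := hnorm_ge0 (u - partial_sum n u).
by have := hnorm_ge0 e; nra.
Qed.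

End Spectral.

(** * Integration against an independent sample *)

Section RestrictedIntegral.
Context {R : realType} d (T : measurableType d).
Local Open Scope ereal_scope.

Lemma ge0_integral_mrestr (m : {measure set T -> \bar R}) (A : set T) (mA : measurable A)
    (f : T -> \bar R) : measurable_fun setT f -> (forall x, 0 <= f x) ->
  \int[mrestr m mA]_x f x = \int[m]_(x in A) f x.
Proof.
move=> mf f0; rewrite -(setvU A) ge0_integral_setU//; last 3 first.
- exact: measurableC.
- by rewrite setvU.
- by apply/disj_setPS => x [].
rewrite (@eq_measure_integral _ _ _ (~` A) mzero); last first.
  move=> B mB BA; rewrite /= /mrestr /mzero.
  by rewrite (_ : B `&` A = set0) ?measure0//; apply/seteqP; split => // x [/BA].
rewrite integral_measure_zero add0e.
by apply: eq_measure_integral => B mB BA; rewrite /= /mrestr setIidl.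
Qed.

(** Independence of [Z] from [A] says that the image under [Z] of [Pr] restricted to [A] is [mu]
    scaled by [Pr A]; the rest is a change of variables. *)
Lemma ge0_integral_indep d' (S : measurableType d') (Pr : probability T R) (mu : probability S R)
    (Z : T -> S) (A : set T) (h : S -> \bar R) :
  measurable_fun setT Z -> measurable A ->
  (forall B, measurable B -> Pr (A `&` Z @^-1` B) = Pr A * mu B) ->
  measurable_fun setT h -> (forall z, 0 <= h z) ->
  \int[Pr]_(x in A) h (Z x) = Pr A * \int[mu]_z h z.
Proof.
move=> mZ mA AZ mh h0.
have mhZ : measurable_fun setT (h \o Z) by exact: measurableT_comp.
rewrite -(ge0_integral_mrestr _ mA mhZ); last by move=> x; exact: h0.
have PA : (0 <= fine (Pr A))%R by exact: fine_ge0.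
rewrite -(ge0_integral_pushforward mZ (mrestr Pr mA) measurableT)//.
rewrite (@eq_measure_integral _ _ _ setT (mscale (NngNum PA) mu)).
  by rewrite ge0_integral_mscale//= fineK// fin_num_measure.
move=> B mB _; rewrite /= /pushforward /mrestr /mscale/= setIC AZ//.
by rewrite fineK// fin_num_measure.
Qed.

End RestrictedIntegral.

Section Conditioning.
Context {k : scalar_kind} {R : realType} {V : hilbertType k R}.
Context d (T : measurableType d) d' (S : measurableType d').
Variables (Pr : probability T R) (mu : probability S R).
Variables (Z : T -> S) (past : set (set T)) (W : T -> V).
Hypothesis Vsep : separable V.
Hypothesis mZ : measurable_fun setT Z.
Hypothesis past_meas : forall A, <<s past >> A -> measurable A.
Hypothesis past_indep : forall A B, <<s past >> A -> measurable B ->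
  (Pr (A `&` Z @^-1` B) = Pr A * mu B)%E.
Hypothesis mW : weakly_measurable (W : g_sigma_algebraType past -> V).

(** [q] picks the first point of a dense sequence within [eps] of [W]. The pieces are the preimages
    of balls made disjoint, so they remain events of the past. *)
Lemma countable_approx (eps : R) : 0 < eps ->
  exists (e : nat -> V) (A : nat -> set T) (q : T -> V),
  [/\ forall i, <<s past >> (A i), trivIset setT A, \bigcup_i A i = setT,
      forall i x, A i x -> q x = e i & forall x, hnorm (W x - q x) < eps].
Proof.
move=> eps0; have [e edense] := separable_seq Vsep.
pose B i := [set x | hnorm (W x - e i) < eps].
have mB i : <<s past >> (B i).
  have mWe := measurable_hnorm Vsep
    (weakly_measurableB mW (weakly_measurable_cst (T := g_sigma_algebraType past) (e i))).
  have := mWe measurableT _ (measurable_itv `]-oo, eps[).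
  by rewrite setTI; congr <<s _ >>; apply/seteqP; split=> x /=; rewrite in_itv.
have ex x : exists i, hnorm (W x - e i) < eps by exact: edense.
exists e, (seqDU B), (fun x => e (ex_minn (ex x))); split.
- move=> i; apply: (@measurableD _ (g_sigma_algebraType past)); first exact: mB.
  by apply: bigsetU_measurable => j _; exact: mB.
- exact: trivIset_seqDU.
- rewrite -seqDU_bigcup_eq; apply/seteqP; split => // x _.
  by have [i xi] := ex x; exists i.
- move=> i x [Bix nBx]; case: ex_minnP => j Bjx jmin; congr e.
  apply/eqP; rewrite eqn_leq jmin//= leqNgt; apply/negP => ji; apply: nBx.
  by rewrite -bigcup_mkord; exists j.
- by move=> x; case: ex_minnP.
Qed.

Variables (F : V -> S -> R) (u : V) (a b K : R).
Hypothesis F0 : forall v z, 0 <= F v z.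
Hypothesis mF : forall v, measurable_fun setT (F v).
Hypothesis mFZ : forall W' : T -> V, weakly_measurable W' ->
  measurable_fun setT (fun x => F (W' x) (Z x)).
Hypothesis cF : forall z v (q : nat -> V), (hnorm (v - q n) @[n --> \oo] --> (0 : R)) ->
  F (q n) z @[n --> \oo] --> F v z.
Hypotheses (a0 : 0 <= a) (b0 : 0 <= b).
Hypothesis leF : forall v, (\int[mu]_z (F v z)%:E <= (a * hnorm (u - v) ^+ 2 + b)%:E)%E.
Hypothesis leK : (\int[Pr]_x (hnorm (u - W x) ^+ 2)%:E <= K%:E)%E.

(** On each past event [A i] the argument [q] is the constant [e i], so the independent sample can
    be integrated out and [leF] applies. Returning from [q] to [W] costs a factor [1 + eps] and a
    small constant. *)
Lemma integral_countable_valued (e : nat -> V) (A : nat -> set T) (q : T -> V) (eps : R) :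
  0 < eps ->
  (forall i, <<s past >> (A i)) -> trivIset setT A -> \bigcup_i A i = setT ->
  (forall i x, A i x -> q x = e i) -> (forall x, hnorm (W x - q x) < eps) ->
  weakly_measurable q /\
  (\int[Pr]_x (F (q x) (Z x))%:E <= (a * ((1 + eps) * K + eps * (1 + eps)) + b)%:E)%E.
Proof.
move=> eps0 pA tA UA qe Wq.
have mA i : measurable (A i) by exact: past_meas.
have mq : weakly_measurable q.
  move=> w; apply: measurable_fun_supercut => c.
  rewrite [X in measurable X](_ : _ = \bigcup_(i in [set i | c < ip (e i) w]) A i).
    by apply: bigcup_measurable => i _; exact: mA.
  apply/seteqP; split=> [x /= cx|x [i /= ci Aix]]; last by rewrite (qe i).
  have : (\bigcup_i A i) x by rewrite UA.
  by move=> [i _ Aix]; exists i => //=; rewrite -(qe i x).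
split=> //.
have mW' : weakly_measurable W.
  move=> w _ B mB; apply: past_meas; exact: (mW w).
have mcst v : weakly_measurable (cst v : T -> V) by exact: weakly_measurable_cst.
have mq2 : measurable_fun setT (fun x => hnorm (u - q x) ^+ 2).
  by apply: measurable_hnorm2 => //; exact: weakly_measurableB.
have mW2 : measurable_fun setT (fun x => hnorm (u - W x) ^+ 2).
  by apply: measurable_hnorm2 => //; exact: weakly_measurableB.
have mdom : measurable_fun setT (fun x => (a * hnorm (u - q x) ^+ 2 + b)%:E).
  by apply/measurable_EFinP; apply: measurable_funD => //; exact: measurable_funM.
apply: (@le_trans _ _ (\int[Pr]_x (a * hnorm (u - q x) ^+ 2 + b)%:E)%E).
  rewrite -UA !ge0_integral_bigcup//; try rewrite UA.
  - apply: lee_nneseries => [i _ _|i _].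
      by apply: integral_ge0 => x _; rewrite lee_fin.
    rewrite (eq_integral (fun x => (F (e i) (Z x))%:E)); last first.
      by move=> x; rewrite inE => /qe ->.
    rewrite [leRHS](eq_integral (fun x => (a * hnorm (u - e i) ^+ 2 + b)%:E)); last first.
      by move=> x; rewrite inE => /qe ->.
    rewrite (@ge0_integral_indep _ _ _ _ _ _ mu _ _ (fun z => (F (e i) z)%:E))//.
    - by rewrite integral_cst// muleC lee_wpmul2r.
    - by move=> B mB; exact: past_indep.
    - by apply/measurable_EFinP; exact: mF.
    - by move=> z; rewrite lee_fin.
  - exact: mdom.
  - by move=> x _; rewrite lee_fin addr_ge0// mulr_ge0// sqr_ge0.
  - by apply/measurable_EFinP; exact: mFZ.
  - by move=> x _; rewrite lee_fin.
apply: (@le_trans _ _ (\int[Pr]_x ((a * (1 + eps))%:E * (hnorm (u - W x) ^+ 2)%:E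
    + (a * (eps * (1 + eps)) + b)%:E))%E).
  apply: ge0_le_integral => //.
  - by move=> x _; rewrite lee_fin addr_ge0// mulr_ge0// sqr_ge0.
  - by apply/measurable_EFinP; apply: measurable_funD => //; exact: measurable_funM.
  - move=> x _; rewrite -EFinM -EFinD lee_fin addrA lerD2r -mulrA -mulrDr ler_wpM2l//.
    have h1 : hnorm (u - q x) <= hnorm (u - W x) + eps.
      have -> : u - q x = (u - W x) + (W x - q x) by rewrite addrA subrK.
      by rewrite (le_trans (hnormD _ _))// lerD2l ltW.
    apply: (@le_trans _ _ ((hnorm (u - W x) + eps) ^+ 2)).
      by rewrite ler_sqr ?nnegrE ?addr_ge0 ?hnorm_ge0// ltW.
    (* With h = |u - W x|, the bound 2 h <= h^2 + 1 gives (h + eps)^2 <= (1 + eps) h^2 + eps (1 +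
       eps). *)
    have := sqr_ge0 (hnorm (u - W x) - 1); nra.
rewrite ge0_integralD//; last 3 first.
- move=> x _; rewrite -EFinM lee_fin mulr_ge0 ?sqr_ge0//.
  by rewrite mulr_ge0// addr_ge0// ltW.
- by apply/measurable_EFinP; exact: measurable_funM.
- by move=> x _; rewrite lee_fin addr_ge0// mulr_ge0// mulr_ge0 ?addr_ge0// ltW.
rewrite ge0_integralZl_EFin//; last 3 first.
- by move=> x _; rewrite lee_fin sqr_ge0.
- by apply/measurable_EFinP.
- by rewrite mulr_ge0// addr_ge0// ltW.
have intc c : (\int[Pr]_x c%:E = c%:E)%E.
  rewrite integral_cst// -[RHS]mule1; congr (_ * _)%E; exact: probability_setT.
rewrite intc.
have -> : a * ((1 + eps) * K + eps * (1 + eps)) + b =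
    a * (1 + eps) * K + (a * (eps * (1 + eps)) + b) by ring.
rewrite [leRHS]EFinD leeD2r// [leRHS]EFinM lee_wpmul2l// lee_fin.
by rewrite mulr_ge0// addr_ge0// ltW.
Qed.

(** This replaces conditioning on the past. The approximations with eps = 1/(n+1) converge pointwise
    to [W], [F] is continuous in its first argument, and Fatou's lemma carries the bounds to their
    limit a K + b. *)
Lemma integral_indep_le : (\int[Pr]_x (F (W x) (Z x))%:E <= (a * K + b)%:E)%E.
Proof.
have /choice[q qP] : forall n, exists q : T -> V, [/\ weakly_measurable q,
    (\int[Pr]_x (F (q x) (Z x))%:E <= (a * ((1 + n.+1%:R^-1) * K + n.+1%:R^-1 * (1 + n.+1%:R^-1)) + b)%:E)%E
    & forall x, hnorm (W x - q x) < n.+1%:R^-1].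
  move=> n; have n0 : 0 < n.+1%:R^-1 :> R by rewrite invr_gt0.
  have [e [A [q [pA tA UA qe Wq]]]] := countable_approx n0.
  by exists q; have [] := integral_countable_valued n0 pA tA UA qe Wq.
have inv0 : (n.+1%:R^-1 : R) @[n --> \oo] --> (0 : R) by exact: cvg_harmonic.
have qF x : (F (q n x) (Z x))%:E @[n --> \oo] --> (F (W x) (Z x))%:E.
  apply: cvg_EFin; first by near=> n.
  apply: cF; apply: (@squeeze_cvgr _ _ _ _ (cst 0) (fun n => n.+1%:R^-1)) => //.
    by near=> n; rewrite hnorm_ge0/= ltW//; have [] := qP n.
  exact: cvg_cst.
rewrite (eq_integral (fun x => limn_einf (fun n => (F (q n x) (Z x))%:E))); last first.
  by move=> x _; have [->] := cvg_limn_einf_sup (qF x).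
apply: le_trans (fatou _ _ _ _) _ => //.
- by move=> n; apply/measurable_EFinP; apply: mFZ; have [] := qP n.
- by move=> n x _; rewrite lee_fin.
rewrite limn_einf_lim.
pose c n : R := a * ((1 + n.+1%:R^-1) * K + n.+1%:R^-1 * (1 + n.+1%:R^-1)) + b.
have cc : c n @[n --> \oo] --> a * K + b.
  rewrite [X in _ --> X](_ : _ = a * ((1 + 0) * K + 0 * (1 + 0)) + b); last by ring.
  apply: cvgD; last exact: cvg_cst.
  apply: cvgM; first exact: cvg_cst.
  have c1 : (1 + n.+1%:R^-1 : R) @[n --> \oo] --> (1 + 0 : R).
    by apply: cvgD => //; exact: cvg_cst.
  apply: cvgD; first by apply: cvgM => //; exact: cvg_cst.
  exact: cvgM.
have cc' : (c n)%:E @[n --> \oo] --> (a * K + b)%:E.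
  by apply: cvg_EFin => //; near=> n.
rewrite -(cvg_lim _ cc')//; apply: lee_lim.
- exact: is_cvg_einfs.
- by apply/cvg_ex; eexists; exact: cc'.
- near=> n; apply: (@le_trans _ _ (\int[Pr]_x (F (q n x) (Z x))%:E)%E).
    by apply: ereal_inf_lbound; exists n => /=.
  by have [] := qP n.
Unshelve. all: by end_near.
Qed.

End Conditioning.

(** * Independence of the past *)

Section Past.
Context {R : realType} d (T : measurableType d) d' (S : measurableType d').
Variable X : nat -> T -> S.

(** Cylinder events of the samples with index below [m]: a pi-system generating the past, in the
    product form for which independence is assumed. *)
Definition past (m : nat) : set (set T) :=
  [set A | exists2 B : nat -> set S, forall i, measurable (B i) &
     A = \bigcap_(i in [set` iota 0 m]) (X i @^-1` B i)].

Lemma past_setI m : setI_closed (past m).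
Proof.
move=> _ _ [B mB ->] [C mC ->]; exists (fun i => B i `&` C i).
  by move=> i; exact: measurableI.
by rewrite -bigcapI.
Qed.

Lemma past_measurable_fun m i : (i < m)%N ->
  measurable_fun setT (X i : g_sigma_algebraType (past m) -> S).
Proof.
move=> im _ B mB; rewrite setTI; apply: sub_sigma_algebra.
exists (fun j => if j == i then B else setT).
  by move=> j; case: ifP.
apply/seteqP; split=> [x Bx j /= _|x /(_ i)/=]; first by case: eqP => [->|].
by rewrite eqxx mem_iota add0n im; exact.
Qed.

Variables (Pr : probability T R) (mu : probability S R) (I : set nat).
Hypothesis iid : iid_samples Pr mu I X.

(** Dynkin's pi-lambda theorem: the events satisfying the product formula with sample [m] form a
    lambda-system containing the cylinders. Measurability is carried along in the same induction. *)
Lemma past_indep m A : (forall i, (i <= m)%N -> I i) -> <<s past m >> A ->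
  measurable A /\ forall B, measurable B -> (Pr (A `&` X m @^-1` B) = Pr A * mu B)%E.
Proof.
case: iid => mX lX indX leI; move: A.
have mXB i B : (i <= m)%N -> measurable B -> measurable (X i @^-1` B).
  by move=> im mB; rewrite -[X in measurable X]setTI; apply: mX => //; exact: leI.
have split_measure A C : measurable A -> measurable C ->
    (Pr (A `&` C) + Pr (~` A `&` C) = Pr C)%E.
  move=> mA mC; rewrite -measureU; first by rewrite -setIUl setUv setTI.
  - exact: measurableI.
  - by apply: measurableI => //; exact: measurableC.
  - by rewrite setIACA setICr set0I.
apply: (@dynkin_induction _ (g_sigma_algebraType (past m)) (past m)) => //.
- exact: past_setI.
- split=> // B mB; rewrite setTI (probability_setT Pr) mul1e.
  exact: lX (leI _ (leqnn _)) _ mB.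
- move=> _ [C mC ->]; split.
    rewrite bigcap_mkcond; apply: bigcapT_measurable => i; case: ifPn => //.
    by rewrite inE /= mem_iota add0n => /ltnW im; exact: mXB.
  (* The cylinder is extended by the event [B] at index [m]; independence is then used once for m +
     1 samples and once, backwards, for the first m. *)
  move=> B mB; pose D i := if i == m then B else C i.
  have mD i : measurable (D i) by rewrite /D; case: ifP.
  have DB : D m = B by rewrite /D eqxx.
  have DC i : i \in iota 0 m -> D i = C i.
    by rewrite mem_iota add0n /D => /andP[_ im]; rewrite ltn_eqF.
  have := indX (rcons (iota 0 m) m) D.
  rewrite rcons_uniq iota_uniq mem_iota add0n ltnn andbF => /(_ isT).
  have Iin i : i \in rcons (iota 0 m) m -> I i /\ measurable (D i).
    rewrite mem_rcons inE mem_iota add0n => im; split=> //; apply: leI.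
    by case/orP: im => [/eqP ->//|/andP[_ /ltnW]].
  move=> /(_ Iin); rewrite big_rcons/= DB (lX m (leI _ (leqnn _)) _ mB).
  have -> : \bigcap_(i in [set` rcons (iota 0 m) m]) (X i @^-1` D i) =
      \bigcap_(i in [set` iota 0 m]) (X i @^-1` C i) `&` X m @^-1` B.
    apply/seteqP; split=> [x Dx|x [Cx Bx] i /=].
      split=> [i /= im|]; first by rewrite -DC//; apply: Dx; rewrite /= mem_rcons inE im orbT.
      by rewrite -DB; apply: Dx; rewrite /= mem_rcons inE eqxx.
    rewrite mem_rcons inE => /orP[/eqP->|im]; first by rewrite DB.
    by rewrite DC//; exact: Cx.
  move=> ->; rewrite (eq_big_seq (fun i => Pr (X i @^-1` C i))); last by move=> i /DC ->.
  rewrite -(indX _ C)//; first exact: iota_uniq.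
  by move=> i; rewrite mem_iota add0n => /andP[_ /ltnW im]; split => //; exact: leI.
- move=> A _ [mA indA]; split=> [|B mB]; first exact: measurableC.
  have mXm := mXB m B (leqnn _) mB.
  have fA : (Pr A * mu B)%E \is a fin_num by rewrite fin_numM// fin_num_measure.
  (* The finite quantity [Pr A * mu B] is added to both sides and cancelled afterwards, since
     subtraction of extended reals is unsafe. *)
  suff : (Pr (~` A `&` X m @^-1` B) + Pr A * mu B = Pr (~` A) * mu B + Pr A * mu B)%E.
    by move=> /(congr1 (fun y => y - Pr A * mu B)%E); rewrite !addeK.
  rewrite -{1}indA// addeC split_measure// -ge0_muleDl// addeC.
  have := split_measure A setT mA measurableT; rewrite !setIT => ->.
  by rewrite (probability_setT Pr) mul1e; exact: lX (leI _ (leqnn _)) _ mB.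
- move=> F _ tF indF; have mF n : d.-measurable (F n) by have [] := indF n.
  split=> [|B mB]; first exact: bigcup_measurable.
  have mXm := mXB m B (leqnn _) mB.
  rewrite setIC setI_bigcupr !measure_bigcup//=; last 2 first.
  - by move=> n _; exact: measurableI.
  - exact: trivIset_setIl.
  have muB : mu B = (fine (mu B))%:E by rewrite fineK// fin_num_measure.
  rewrite muleC muB -nneseriesZl//; apply: eq_eseriesr => n _.
  by rewrite -muB muleC setIC; have [_ ->] := indF n.
Qed.

End Past.

(** * The Bochner integral *)

Section BochnerPairing.
Context {k : scalar_kind} {R : realType} {V : hilbertType k R}.
Context d (T : measurableType d) (mu : probability T R).

(** Integrability and value travel together, so that long linear combinations can be integrated by
    chaining this step. *)
Lemma RintegralMD (c : R) (f g : T -> R) :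
  mu.-integrable setT (EFin \o f) -> mu.-integrable setT (EFin \o g) ->
  mu.-integrable setT (EFin \o (fun z => c * f z + g z)) /\
  Rintegral mu setT (fun z => c * f z + g z) = c * Rintegral mu setT f + Rintegral mu setT g.
Proof.
move=> intf intg.
have intcf : mu.-integrable setT (EFin \o (fun z => c * f z)) by exact: (integrableZl measurableT c intf).
split; last by rewrite RintegralD// RintegralZl.
exact: (integrableD measurableT intcf intg).
Qed.

Lemma Rintegral_cstP (c : R) :
  mu.-integrable setT (EFin \o (fun _ : T => c)) /\ Rintegral mu setT (fun=> c) = c.
Proof.
have ic : (\int[mu]_(x in setT) c%:E = c%:E)%E.
  by rewrite integral_cst// -[RHS]mule1; congr (_ * _)%E; exact: probability_setT.
split; last by rewrite /Rintegral ic.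
exact: finite_measure_integrable_cst.
Qed.

Lemma Rintegral_sum (I : Type) (r : seq I) (f : I -> T -> R) (Q : I -> Prop) :
  (forall i, Q i -> mu.-integrable setT (EFin \o f i)) ->
  List.Forall Q r ->
  mu.-integrable setT (EFin \o (fun z => \sum_(i <- r) f i z)) /\
  Rintegral mu setT (fun z => \sum_(i <- r) f i z) = \sum_(i <- r) Rintegral mu setT (f i).
Proof.
move=> intf; elim=> [|i l Qi Ql [ih1 ih2]].
  under eq_fun do rewrite big_nil; rewrite big_nil; exact: Rintegral_cstP.
have [h1 h2] := RintegralMD 1 (intf _ Qi) ih1.
have E : (fun z => \sum_(j <- i :: l) f j z) = (fun z => 1 * f i z + \sum_(j <- l) f j z).
  by apply/funext => z; rewrite big_cons mul1r.
by rewrite E h2 mul1r big_cons ih2.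
Qed.

Hypothesis Vsep : separable V.

Lemma ip_indic (A : set T) (z : T) (v w : V) :
  ip ((\1_A z : scalars k R) *: v) w = ip v w * \1_A z.
Proof.
rewrite !indicE; case: (_ \in _); first by rewrite scale1r mulr1.
by rewrite scale0r ip0l mulr0.
Qed.

Lemma simple_pairing (l : seq (set T * V)) (w : V) :
  (forall p, p \in l -> measurable p.1 /\ (mu p.1 < +oo)%E) ->
  mu.-integrable setT (EFin \o (fun z => ip (simple_fun l z) w)) /\
  Rintegral mu setT (fun z => ip (simple_fun l z) w) = ip (simple_integral mu l) w.
Proof.
move=> ml.
pose f (p : set T * V) (z : T) : R := ip p.2 w * \1_(p.1) z.
have E : (fun z => ip (simple_fun l z) w) = (fun z => \sum_(p <- l) f p z).
  apply/funext => z; rewrite ipC /simple_fun ip_sum; apply: eq_bigr => p _.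
  by rewrite ipC ip_indic.
have intind (A : set T) : measurable A -> mu.-integrable setT (EFin \o (\1_A : T -> R)).
  by move=> mA; exact: integrable_indic.
have intf p : measurable p.1 -> mu.-integrable setT (EFin \o f p).
  by move=> mp; exact: (integrableZl measurableT _ (intind _ mp)).
have [] := @Rintegral_sum _ l f (fun p => measurable p.1) intf.
  apply/List.Forall_forall => p pl; apply: (ml p _).1.
  by elim: l pl {ml E} => //= q l ih [->|/ih]; rewrite inE ?eqxx// => ->; rewrite orbT.
rewrite E => h1 ->; split=> //.
rewrite [RHS]ipC /simple_integral ip_sum; apply: eq_big_seq => p pl.
have mp := (ml p pl).1.
rewrite ipZr ipC /f RintegralZl//; last exact: intind.
by rewrite mulrC /Rintegral integral_indic// setIT.
Qed.

(** For simple functions the pairing commutes with the integral. The error is at most |w| times the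
    mean distance to [f], which tends to 0, while the integrals of the simple functions tend to
    [J]. *)
Lemma bochner_pairing (f : T -> V) (J w : V) : weakly_measurable f ->
  mu.-integrable setT (EFin \o (fun z => ip (f z) w)) ->
  is_bochner_integral mu f J ->
  Rintegral mu setT (fun z => ip (f z) w) = ip J w.
Proof.
move=> mf intf [l [ml _ cf cJ]].
set A := Rintegral _ _ _.
have mg n : weakly_measurable (simple_fun (l n)).
  move=> x; have [+ _] := simple_pairing x (ml n).
  by move=> /integrableP[] /measurable_EFinP.
have bound n : (`|A - ip (simple_integral mu (l n)) w|%:E <=
    (hnorm w)%:E * \int[mu]_z (hnorm (f z - simple_fun (l n) z))%:E)%E.
  have [i1 e1] := simple_pairing w (ml n).
  have mh : measurable_fun setT (fun z => hnorm (f z - simple_fun (l n) z)).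
    by apply: measurable_hnorm => //; exact: weakly_measurableB.
  have [i2 e2] := RintegralMD (-1) i1 intf.
  rewrite -e1 addrC -mulN1r /A -e2 -ge0_integralZl_EFin//; last 3 first.
  - by move=> z _; rewrite lee_fin hnorm_ge0.
  - exact/measurable_EFinP.
  - exact: hnorm_ge0.
  rewrite /Rintegral -abse_EFin fineK; last exact: integrable_fin_num.
  apply: le_trans (le_abse_integral mu measurableT _) _.
    by have /integrableP[] := i2.
  apply: ge0_le_integral => //.
  - by have /integrableP[+ _] := i2; exact: measurableT_comp.
  - by apply/measurable_EFinP; exact: measurable_funM.
  move=> z _ /=; rewrite -EFinM lee_fin mulN1r addrC -ipNl -ipDl mulrC.
  exact: ip_cauchy_schwarz.
have c1 : (`|A - ip (simple_integral mu (l n)) w|%:E @[n --> \oo] --> `|A - ip J w|%:E)%E.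
  apply: cvg_EFin; first by near=> n.
  apply: cvg_norm; apply: cvgB; first exact: cvg_cst.
  apply: (@cvg_comp _ _ _ (fun n => simple_integral mu (l n)) (ip^~ w) _ _ _ cJ).
  exact: continuous_ip.
have c2 : ((hnorm w)%:E * \int[mu]_z (hnorm (f z - simple_fun (l n) z))%:E @[n --> \oo]
    --> 0)%E.
  rewrite -[0%E](mule0 (hnorm w)%:E); exact: cvgeZl.
have : (`|A - ip J w|%:E <= 0)%E.
  rewrite -(cvg_lim _ c1)// -(cvg_lim _ c2)//; apply: lee_lim.
  - by apply/cvg_ex; eexists; exact: c1.
  - by apply/cvg_ex; eexists; exact: c2.
  - by near=> n; exact: bound.
by rewrite lee_fin normr_le0 subr_eq0 => /eqP.
Unshelve. all: by end_near.
Qed.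

End BochnerPairing.

(** * The online step *)

Section Family.
Context {R : realType} {k : scalar_kind} {Y V : hilbertType k R} {Omega : pmetricType R}.
Hypotheses (Ysep : separable Y) (Vsep : separable V).
Variables (Rop : Omega -> {linear Y -> V}) (Rs : Omega -> V -> Y) (L : R).
Hypothesis Rcont : forall w, continuous (Rop w).
Hypothesis adj : forall w, is_adjoint (Rop w) (Rs w).
Hypothesis Rmeas : forall (y : Y) (v : V),
     measurable_fun [set: borel Omega]
       ((fun w => inner (Rop w y) v) : borel Omega -> borel (scalars k R)).
Hypothesis Rbound : forall w, opnorm (Rop w) ^+ 2 <= L.

Section Measurable.
Context d (T : measurableType d) (o : T -> borel Omega).
Hypothesis mo : measurable_fun setT o.

Lemma weakly_measurable_Rop_cst y : weakly_measurable (fun x => Rop (o x) y).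
Proof.
move=> w; have msre := @continuous_borel_measurable R _ _ (@continuous_sre R k).
have m1 := measurableT_comp (Rmeas y w) mo.
exact: (measurableT_comp msre m1).
Qed.

Lemma weakly_measurable_Rs W : weakly_measurable W ->
  weakly_measurable (fun x => Rs (o x) (W x)).
Proof.
move=> mW y; under eq_fun do rewrite ipC -(ip_adjoint (adj _)).
by apply: measurable_ip => //; exact: weakly_measurable_Rop_cst.
Qed.

Lemma weakly_measurable_Rop W : weakly_measurable W ->
  weakly_measurable (fun x => Rop (o x) (W x)).
Proof.
move=> mW v; under eq_fun do rewrite (ip_adjoint (adj _)).
apply: measurable_ip => //.
exact: (weakly_measurable_Rs (weakly_measurable_cst v)).
Qed.

End Measurable.

Let S := borel (Omega * Y)%type.

Definition online_step (a c : R) (v : V) (z : Omega * Y) : V :=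
  of_real k a *: (v + of_real k c *: Rop z.1 (z.2 - Rs z.1 v)).

Lemma measurable_fst_borel : measurable_fun [set: S] (fst : S -> borel Omega).
Proof. by apply: continuous_borel_borel => x; exact: cvg_fst. Qed.

Section StepMeasurable.
Context d (T : measurableType d).

Lemma weakly_measurable_snd (Z : T -> S) : measurable_fun setT Z ->
  weakly_measurable (fun x => (Z x).2).
Proof.
move=> mZ y.
have cont : continuous (fun z : Omega * Y => ip z.2 y).
  move=> z; apply: (@cvg_comp _ _ _ snd (ip^~ y) _ _ _ cvg_snd).
  exact: continuous_ip.
exact: (measurableT_comp (continuous_borel_measurable cont) mZ).
Qed.

Lemma weakly_measurable_step a c (Z : T -> S) (W : T -> V) :
  measurable_fun setT Z -> weakly_measurable W ->
  weakly_measurable (fun x => online_step a c (W x) (Z x)).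
Proof.
move=> mZ mW; have mo := measurableT_comp measurable_fst_borel mZ.
apply: weakly_measurableZ; apply: weakly_measurableD => //.
apply: weakly_measurableZ; apply: (weakly_measurable_Rop mo).
apply: weakly_measurableB; first exact: weakly_measurable_snd.
exact: (weakly_measurable_Rs mo).
Qed.

Lemma weakly_measurable_iterate A t u0 (X : nat -> T -> S) m :
  (forall i, (i < m)%N -> measurable_fun setT (X i)) ->
  weakly_measurable (fun x => online_iterate Rop Rs A t u0 (fun j => X j x) m).
Proof.
elim: m => [|m ih] mX; first exact: weakly_measurable_cst.
apply: weakly_measurable_step; first exact: mX.
by apply: ih => i im; apply: mX; exact: ltnW.
Qed.

End StepMeasurable.

Lemma L_ge0 : 0 <= L.
Proof. exact: le_trans (sqr_ge0 _) (Rbound point). Qed.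

(** The step is affine in [v], with linear part v |-> a (v - c Rop (Rs v)), and [Rop] composed with
    [Rs] has norm at most [L]. This supplies the continuity used in the limit passage for the
    iterate. *)
Lemma online_step_lipschitz a c v v' z :
  hnorm (online_step a c v z - online_step a c v' z) <=
  `|a| * (1 + `|c| * L) * hnorm (v - v').
Proof.
have -> : online_step a c v z - online_step a c v' z =
    of_real k a *: ((v - v') - of_real k c *: Rop z.1 (Rs z.1 (v - v'))).
  rewrite /online_step -scalerBr; congr (_ *: _).
  rewrite (adjointD (adj _)) (adjointN (adj _)) opprD addrACA; congr (_ + _).
  rewrite -scalerBr -scalerN -linearB -linearN; congr (_ *: Rop _ _).
  by rewrite opprB addrC addrA subrK opprD opprK addrC.
rewrite hnormZ -mulrA ler_wpM2l//.
rewrite (le_trans (hnormD _ _))// hnormN hnormZ mulrDl mul1r lerD2l -mulrA ler_wpM2l//.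
rewrite -ler_sqr ?nnegrE ?mulr_ge0 ?hnorm_ge0 ?L_ge0//.
apply: le_trans (hnorm2_op (@Rcont z.1) (Rbound z.1) _) _.
rewrite exprMn expr2 -mulrA ler_wpM2l ?L_ge0//.
exact: (hnorm2_adjoint (@Rcont z.1) (adj z.1) (Rbound z.1)).
Qed.

Lemma cvg_hnorm2_step a c (u v : V) (q : nat -> V) z :
  (hnorm (v - q n) @[n --> \oo] --> (0 : R)) ->
  hnorm (u - online_step a c (q n) z) ^+ 2 @[n --> \oo] -->
  hnorm (u - online_step a c v z) ^+ 2.
Proof.
move=> vq.
have h : hnorm (u - online_step a c (q n) z) @[n --> \oo] -->
    hnorm (u - online_step a c v z).
  apply/cvgrPdist_le => e e0.
  have : `|a| * (1 + `|c| * L) * hnorm (v - q n) @[n --> \oo] -->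
      `|a| * (1 + `|c| * L) * 0 by apply: cvgM => //; exact: cvg_cst.
  rewrite mulr0 => /cvgrPdist_le/(_ e e0); apply: filterS => n.
  rewrite sub0r normrN ger0_norm; last first.
    by rewrite mulr_ge0 ?hnorm_ge0// mulr_ge0// addr_ge0// mulr_ge0// L_ge0.
  apply: le_trans; apply: le_trans (online_step_lipschitz a c v (q n) z).
  have -> : online_step a c v z - online_step a c (q n) z =
      - ((u - online_step a c v z) - (u - online_step a c (q n) z)).
    by rewrite opprB opprB [RHS]addrC addrA subrK.
  by rewrite hnormN hnorm_dist.
exact: (cvgM h h).
Qed.

End Family.

(** * The expected error after one step *)

Section StepIntegral.
Context {R : realType} {k : scalar_kind} {Y V : hilbertType k R} {Omega : pmetricType R}.
Hypotheses (Ysep : separable Y) (Vsep : separable V).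
Variables (mu : probability (borel (Omega * Y)%type) R) (rho : probability (borel Omega) R).
Hypothesis hrho : forall B : set (borel Omega), measurable B -> rho B = mu (fst @^-1` B).
Hypothesis hy2 : (\int[mu]_z (hnorm z.2 ^+ 2)%:E < +oo)%E.
Variables (Rop : Omega -> {linear Y -> V}) (Rs : Omega -> V -> Y) (L : R).
Hypothesis Rcont : forall w, continuous (Rop w).
Hypothesis adj : forall w, is_adjoint (Rop w) (Rs w).
Hypothesis Rmeas : forall (y : Y) (v : V),
     measurable_fun [set: borel Omega]
       ((fun w => inner (Rop w y) v) : borel Omega -> borel (scalars k R)).
Hypothesis Rbound : forall w, opnorm (Rop w) ^+ 2 <= L.
Variable P : {linear V -> V}.
Hypothesis hP : forall v w : V,
     inner (P v) w = scalar_integral rho (fun o => inner (Rs o v) (Rs o w)).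
Variables (ERy u : V).
Hypothesis hERy : is_bochner_integral mu (fun z => Rop z.1 z.2) ERy.
Hypothesis hu : P u = ERy.

Let S := borel (Omega * Y)%type.
Let mid : measurable_fun [set: S] (id : S -> S) := @measurable_id _ _ _.
Let wm_Rs v : weakly_measurable (fun z : S => Rs z.1 v) :=
  weakly_measurable_Rs Vsep adj Rmeas (@measurable_fst_borel _ _ _ _) (weakly_measurable_cst v).
Let wm_y : weakly_measurable (fun z : S => z.2) := weakly_measurable_snd mid.

(** All integrands below grow at most quadratically in [y], so the second moment of [y] and the
    finiteness of [mu] dominate them. *)
Lemma integrable_dominated (f : S -> R) (c : R) : measurable_fun setT f ->
  (forall z : S, `|f z| <= c * (hnorm z.2 ^+ 2 + 1)) -> mu.-integrable setT (EFin \o f).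
Proof.
move=> mf fc.
have inty : mu.-integrable setT (EFin \o (fun z : S => hnorm z.2 ^+ 2)).
  apply/integrableP; split; first by apply/measurable_EFinP; exact: measurable_hnorm2.
  by under eq_integral do rewrite /= ger0_norm ?sqr_ge0//.
have [] := RintegralMD 1 inty (Rintegral_cstP mu 1).1 => int1 _.
apply: (le_integrable measurableT _ _ (integrableZl measurableT c int1)).
  exact/measurable_EFinP.
move=> z _ /=; rewrite lee_fin mul1r (le_trans (fc z))//.
exact: ler_norm.
Qed.

(** [P] is defined by an integral over the marginal [rho]; the image of [mu] under [fst] is [rho],
    which turns it into an integral over the samples. *)
Lemma Rintegral_RsRs v w :
  mu.-integrable setT (EFin \o (fun z => ip (Rs z.1 v) (Rs z.1 w))) /\
  Rintegral mu setT (fun z => ip (Rs z.1 v) (Rs z.1 w)) = ip (P v) w.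
Proof.
have int : mu.-integrable setT (EFin \o (fun z => ip (Rs z.1 v) (Rs z.1 w))).
  apply: (@integrable_dominated _ (L * (hnorm v ^+ 2 + hnorm w ^+ 2))).
    exact: measurable_ip.
  move=> z; have hv := hnorm2_adjoint (@Rcont z.1) (adj z.1) (Rbound z.1) v.
  have hw := hnorm2_adjoint (@Rcont z.1) (adj z.1) (Rbound z.1) w.
  have := ip_cauchy_schwarz (Rs z.1 v) (Rs z.1 w).
  have := sqr_ge0 (hnorm z.2); have := sqr_ge0 (hnorm (Rs z.1 v) - hnorm (Rs z.1 w)).
  move: (sqr_ge0 (hnorm (Rs z.1 v))) (sqr_ge0 (hnorm (Rs z.1 w))).
  nra.
split=> //.
have mo : measurable_fun [set: borel Omega] (fun o => ip (Rs o v) (Rs o w)).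
  by apply: measurable_ip => //; apply: (weakly_measurable_Rs Vsep adj Rmeas (@measurable_id _ _ _));
    exact: weakly_measurable_cst.
have -> : ip (P v) w = Rintegral rho setT (fun o => ip (Rs o v) (Rs o w)).
  by rewrite /ip hP /scalar_integral sre_smk.
rewrite /Rintegral; congr fine.
have mo' : measurable_fun [set: borel Omega] (fun o => (ip (Rs o v) (Rs o w))%:E).
  exact/measurable_EFinP.
have := integral_pushforward (@measurable_fst_borel _ _ _ _) (mu := mu) mo' int measurableT.
rewrite preimage_setT => <-.
apply: eq_measure_integral; first exact: (@measurable_fst_borel _ _ _ _).
by move=> mfst A mA _; rewrite /= /pushforward; exact/esym/hrho.
Qed.

Lemma ipP_sym v w : ip (P v) w = ip (P w) v.
Proof.
by rewrite -(Rintegral_RsRs v w).2 -(Rintegral_RsRs w v).2; congr Rintegral;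
  apply/funext => z; rewrite ipC.
Qed.

Definition noise (z : Omega * Y) : Y := z.2 - Rs z.1 u.

Let wm_noise : weakly_measurable (noise : S -> Y).
Proof. exact: weakly_measurableB. Qed.

Lemma integrable_noise2 : mu.-integrable setT (EFin \o (fun z => hnorm (noise z) ^+ 2)).
Proof.
apply: (@integrable_dominated _ (2 * (1 + L * hnorm u ^+ 2))).
  exact: measurable_hnorm2.
move=> z; rewrite ger0_norm ?sqr_ge0//.
have := hnorm2_adjoint (@Rcont z.1) (adj z.1) (Rbound z.1) u.
have : hnorm (noise z) <= hnorm z.2 + hnorm (Rs z.1 u).
  by rewrite /noise (le_trans (hnormD _ _))// hnormN.
have := L_ge0 Rbound; have := sqr_ge0 (hnorm u).
have := hnorm_ge0 (noise z); have := hnorm_ge0 (z.2); have := hnorm_ge0 (Rs z.1 u).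
set n := hnorm (noise z); set y := hnorm z.2; set r := hnorm (Rs z.1 u); set h := hnorm u ^+ 2.
move=> r0 y0 n0 h0 L0 nyr rL.
have n2 : n ^+ 2 <= (y + r) ^+ 2 by rewrite ler_sqr ?nnegrE ?addr_ge0.
have := sqr_ge0 (y - r); have : 0 <= L * h by exact: mulr_ge0.
have := sqr_ge0 y; nra.
Qed.

(** The normal equation: the integral is (E(R y), v) - (P u, v), and P u = E(R y). *)
Lemma Rintegral_Rs_noise v :
  mu.-integrable setT (EFin \o (fun z => ip (Rs z.1 v) (noise z))) /\
  Rintegral mu setT (fun z => ip (Rs z.1 v) (noise z)) = 0.
Proof.
have [i1 e1] := Rintegral_RsRs v u.
have inty : mu.-integrable setT (EFin \o (fun z => ip (Rop z.1 z.2) v)).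
  apply: (@integrable_dominated _ (1 + L * hnorm v ^+ 2)).
    by under eq_fun do rewrite (ip_adjoint (adj _)); exact: measurable_ip.
  move=> z; rewrite (ip_adjoint (adj _)).
  have := hnorm2_adjoint (@Rcont z.1) (adj z.1) (Rbound z.1) v.
  have := ip_cauchy_schwarz z.2 (Rs z.1 v).
  have := sqr_ge0 (hnorm z.2 - hnorm (Rs z.1 v)).
  have := mulr_ge0 (L_ge0 Rbound) (sqr_ge0 (hnorm v)).
  have := sqr_ge0 (hnorm z.2); have := sqr_ge0 (hnorm (Rs z.1 v)).
  nra.
have e2 : Rintegral mu setT (fun z => ip (Rop z.1 z.2) v) = ip ERy v.
  apply: bochner_pairing => // w.
  under eq_fun do rewrite (ip_adjoint (adj _)).
  exact: (measurable_ip Ysep wm_y (wm_Rs w)).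
have [i3 e3] := RintegralMD (-1) i1 inty.
have E : (fun z => ip (Rs z.1 v) (noise z)) =
    (fun z => -1 * ip (Rs z.1 v) (Rs z.1 u) + ip (Rop z.1 z.2) v).
  apply/funext => z; rewrite /noise ipDr ipNr (ip_adjoint (adj _)) (ipC z.2); ring.
rewrite E; split=> //; rewrite e3 e1 e2 -hu (ipP_sym u v); ring.
Qed.

Lemma ipP_ge0 v : 0 <= ip (P v) v.
Proof.
rewrite -(Rintegral_RsRs v v).2; apply: Rintegral_ge0 => z _; exact: ipxx_ge0.
Qed.

Lemma ipP_le v : ip (P v) v <= L * hnorm v ^+ 2.
Proof.
have [ic ec] := Rintegral_cstP mu (L * hnorm v ^+ 2).
have [i1 <-] := Rintegral_RsRs v v; rewrite -ec.
apply: le_Rintegral => // z _; rewrite -hnorm2E.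
exact: (hnorm2_adjoint (@Rcont z.1) (adj z.1) (Rbound z.1)).
Qed.

(** The new error is w - a c R (R^T e + noise), with R^T the adjoint. Expanding the square and using
    |R q|^2 <= L |q|^2 leaves terms that integrate exactly; those linear in the noise vanish. *)
Lemma integral_step_le (a c : R) (v : V) : 0 <= a -> 0 <= c ->
  (\int[mu]_z (hnorm (u - online_step Rop Rs a c v z) ^+ 2)%:E <=
   (hnorm (u - of_real k a *: v) ^+ 2
    - 2 * (a * c) * ip (P (u - of_real k a *: v)) (u - v)
    + (a * c) ^+ 2 * L * (ip (P (u - v)) (u - v)
       + Rintegral mu setT (fun z => hnorm (noise z) ^+ 2)))%:E)%E.
Proof.
move=> a0 c0; set w := u - of_real k a *: v; set e := u - v.
set sigma2 := Rintegral _ _ _.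
(* [G] is the pointwise majorant, nested so that [RintegralMD] integrates it from the inside out. *)
pose G (z : S) := - (2 * (a * c)) * ip (Rs z.1 w) (Rs z.1 e) +
  (- (2 * (a * c)) * ip (Rs z.1 w) (noise z) +
  (((a * c) ^+ 2 * L) * ip (Rs z.1 e) (Rs z.1 e) +
  (((a * c) ^+ 2 * L * 2) * ip (Rs z.1 e) (noise z) +
  (((a * c) ^+ 2 * L) * hnorm (noise z) ^+ 2 + hnorm w ^+ 2)))).
have [ic ec] := Rintegral_cstP mu (hnorm w ^+ 2).
have [i1 e1] := RintegralMD ((a * c) ^+ 2 * L) integrable_noise2 ic.
have [j2 f2] := Rintegral_Rs_noise e.
have [i2 e2] := RintegralMD ((a * c) ^+ 2 * L * 2) j2 i1.
have [j3 f3] := Rintegral_RsRs e e.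
have [i3 e3] := RintegralMD ((a * c) ^+ 2 * L) j3 i2.
have [j4 f4] := Rintegral_Rs_noise w.
have [i4 e4] := RintegralMD (- (2 * (a * c))) j4 i3.
have [j5 f5] := Rintegral_RsRs w e.
have [i5 e5] := RintegralMD (- (2 * (a * c))) j5 i4.
have -> : hnorm w ^+ 2 - 2 * (a * c) * ip (P w) e + (a * c) ^+ 2 * L * (ip (P e) e + sigma2)
    = Rintegral mu setT G.
  by rewrite /G e5 e4 e3 e2 e1 ec f2 f3 f4 f5 -/sigma2; ring.
rewrite /Rintegral fineK; last exact: integrable_fin_num.
apply: ge0_le_integral => //.
- by move=> z _; rewrite lee_fin sqr_ge0.
- apply/measurable_EFinP; apply: measurable_hnorm2 => //.
  apply: weakly_measurableB; first exact: weakly_measurable_cst.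
  by apply: (weakly_measurable_step Ysep Vsep adj Rmeas) => //; exact: weakly_measurable_cst.
- by have /integrableP[] := i5.
move=> z _; rewrite lee_fin /G.
have -> : u - online_step Rop Rs a c v z =
    w - of_real k (a * c) *: Rop z.1 (Rs z.1 e + noise z).
  rewrite /online_step scalerDr scalerA -of_realM opprD addrA /w /e /noise.
  congr (_ - _ *: Rop _ _).
  by rewrite (adjointD (adj _)) (adjointN (adj _)) [RHS]addrC addrA subrK.
have hRq := hnorm2_op (@Rcont z.1) (Rbound z.1) (Rs z.1 e + noise z).
have := ler_wpM2l (sqr_ge0 (a * c)) hRq.
have [q qE] : exists q, q = Rs z.1 e + noise z by exists (Rs z.1 e + noise z).
rewrite !hnorm2E -qE.
have hw : ip (Rop z.1 q) w = ip q (Rs z.1 w) by rewrite (ip_adjoint (adj _)).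
move: (Rs z.1 e) (Rs z.1 w) (noise z) (Rop z.1 q) qE hw => re rw nz Rq qE hw.
clearbody w e; rewrite !ipE (ipC w Rq) hw qE !ipE (ipC re rw) (ipC nz re) (ipC nz rw).
lra.
Qed.

End StepIntegral.

(** * The scalar recursion *)

Section Recursion.
Context {R : realType}.
Implicit Types (s n L : R).

(** The one-step bound multiplied by (n+1)^2. Here h = |u|^2, E = |e|^2, x = (u,e), a = (P e,e), b =
    (P u,u), c = (P u,e), q = (L/nu)^s and Q = L^s. *)
Lemma recursion_algebra n nu L s Q q U sigma2 h E x a b c :
  0 < L -> 0 < s <= 1 -> 1 <= nu <= n -> n * q = Q * nu ^+ 2 ->
  0 <= h -> 0 <= a -> 0 <= sigma2 -> b <= L * h -> 0 <= 4 * b + 4 * n * c + n ^+ 2 * a ->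
  2 * x <= s * nu / (2 * L) * a + (1 - s) / 2 * E + 2 * q * U ->
  h + n * (2 * x) + n ^+ 2 * E - 2 * (nu / (2 * L)) * (c + n * a)
    + (nu / (2 * L)) ^+ 2 * L * (a + sigma2)
  <= n ^+ 2 * E + n * ((1 - s) / 2) * E
     + nu ^+ 2 * (2 * Q * U + sigma2 / (4 * L) + 2 * h).
Proof.
move=> L0 /andP[s0 s1] /andP[nu1 nun] nq h0 a0 sig0 bh cs xb.
have n0 : 0 < n by lra.
have nu0 : 0 < nu by lra.
set g := nu / (2 * L); have g0 : 0 < g by rewrite divr_gt0// mulr_gt0.
have gL : g * L = nu / 2 by rewrite /g; field; rewrite gt_eqF.
have x' : n * (2 * x) <= n * s * g * a + n * ((1 - s) / 2) * E + nu ^+ 2 * (2 * Q * U).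
  have := ler_wpM2l (ltW n0) xb; congr (_ <= _).
  rewrite [in RHS](_ : nu ^+ 2 * (2 * Q * U) = 2 * U * (Q * nu ^+ 2)); last by ring.
  by rewrite -nq /g; field; rewrite gt_eqF.
(* The cross term has no sign. It is controlled by positivity of [P] at 2u + n e, scaled by g/(2n),
   and by g L = nu/2 <= n/2. *)
have c' : - (2 * g * c) <= h + g * n * a / 2.
  have : 0 <= g / (2 * n) * (4 * b + 4 * n * c + n ^+ 2 * a).
    by rewrite mulr_ge0// ltW// divr_gt0// mulr_gt0.
  have -> : g / (2 * n) * (4 * b + 4 * n * c + n ^+ 2 * a) =
      2 * (g / n * b) + 2 * g * c + g * n * a / 2 by field; rewrite gt_eqF.
  have : g / n * b <= h / 2.
    apply: (@le_trans _ _ (g / n * (L * h))).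
      by rewrite ler_wpM2l// ltW// divr_gt0.
    have -> : g / n * (L * h) = (g * L) / n * h by ring.
    rewrite gL [leRHS]mulrC ler_wpM2r// ler_pdivrMr//; lra.
  lra.
have sg : g ^+ 2 * L * sigma2 = nu ^+ 2 * (sigma2 / (4 * L)).
  by rewrite /g; field; rewrite gt_eqF.
have ga : g ^+ 2 * L * a <= g * n * a / 2.
  have -> : g ^+ 2 * L * a = g * (g * L) * a by ring.
  rewrite gL.
  have := mulr_ge0 (mulr_ge0 (ltW g0) a0) (_ : 0 <= n - nu); rewrite subr_ge0 => /(_ nun); lra.
have hs : h <= nu ^+ 2 * h by rewrite ler_peMl// exprn_ege1.
have sa : n * s * g * a <= n * g * a.
  by rewrite ler_wpM2r// ler_wpM2r ?(ltW g0)// ler_piMr ?(ltW n0).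
(* The negative term -2 g n a is spent exactly: g n a on the smoothness estimate, and g n a / 2 each
   on the cross term and on the quadratic term. The two copies of h are absorbed in 2 nu^2 h. *)
rewrite [_ * (a + sigma2)]mulrDr sg; lra.
Qed.

(* The quantity nu of the header. *)
Definition rate s (n : R) : R := n `^ (2 + s)^-1.

Section Rate.
Variables (s n : R).
Hypotheses (s01 : 0 < s <= 1) (n1 : 1 <= n).

Let s0 : 0 < 2 + s. Proof. by case/andP: s01 => ? _; lra. Qed.
Let n0 : 0 < n. Proof. exact: lt_le_trans ltr01 n1. Qed.

Lemma rate_gt0 : 0 < rate s n.
Proof. exact: powR_gt0. Qed.

Lemma rate_bounds : 1 <= rate s n <= n.
Proof.
rewrite /rate; apply/andP; split.
  by rewrite -[X in X <= _](powRr0 n) ler_powR// invr_ge0 ltW.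
rewrite -[leRHS]powRr1 ?(ltW n0)// ler_powR// invf_le1//.
by case/andP: s01 => ? _; lra.
Qed.

Lemma rate_step : n `^ ((1 + s) / (2 + s)) = n / rate s n.
Proof.
have -> : (1 + s) / (2 + s) = 1 - (2 + s)^-1 by field; rewrite gt_eqF.
by rewrite powRB ?powRr1 ?(ltW n0)// (gt_eqF n0) implybT.
Qed.

Lemma rate_sqr : n `^ (- (s / (2 + s))) = rate s n ^+ 2 / n.
Proof.
have -> : - (s / (2 + s)) = (2 + s)^-1 * 2 - 1 by field; rewrite gt_eqF.
rewrite powRB ?powRr1 ?(ltW n0)// ?(gt_eqF n0) ?implybT//.
by rewrite powRrM powR_mulrn// powR_ge0.
Qed.

(** This balance explains the exponent in [rate]: n nu^(-s) = nu^2 forces nu = n^(1/(2+s)). *)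
Lemma rate_powR L : 0 < L -> n * (L / rate s n) `^ s = L `^ s * rate s n ^+ 2.
Proof.
move=> L0; have r0 := rate_gt0.
have rs : (rate s n)^-1 `^ s = n `^ (- (s / (2 + s))).
  rewrite -powR_inv1 ?(ltW r0)// /rate -!powRrM; congr powR.
  by field; rewrite gt_eqF.
rewrite powRM ?(ltW L0) ?invr_ge0 ?(ltW r0)// rs rate_sqr//.
by field; rewrite gt_eqF.
Qed.

(** Since x nu(x)^2 = x^(1 + 2/(2+s)), this is Bernoulli's inequality at 1 + 1/n. As s <= 1 the
    exponent is at least 5/3, hence above the 3/2 that the induction consumes. *)
Lemma rate_succ : rate s n ^+ 2 * (n + 3 / 2) <= (n + 1) * rate s (n + 1) ^+ 2.
Proof.
have n1' : 0 < n + 1 by exact: addr_gt0.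
have E x : 0 < x -> x * rate s x ^+ 2 = x `^ (1 + (2 + s)^-1 * 2).
  move=> x0; rewrite powRD ?(gt_eqF x0) ?implybT// powRr1 ?(ltW x0)//.
  by rewrite powRrM powR_mulrn// powR_ge0.
rewrite E// (_ : n + 1 = n * (1 + n^-1)); last by field; rewrite gt_eqF.
have in0 : 0 <= n^-1 by rewrite invr_ge0 ltW.
rewrite powRM ?(ltW n0)//; last by rewrite addr_ge0.
rewrite -(E n)// -[leLHS]mulrC.
have p3 : 3^-1 <= (2 + s)^-1 by case/andP: s01 => ? ?; rewrite lef_pV2 ?posrE//; lra.
have q1 : 1 <= 1 + (2 + s)^-1 * 2 by rewrite lerDl mulr_ge0// invr_ge0 ltW.
have := bernoulli_powR q1 (_ : 0 <= 1 + n^-1); rewrite addr_ge0// => /(_ isT).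
set B := _ `^ _ => HB.
have HB' : 1 + 3 / 2 * n^-1 <= B.
  apply: le_trans HB; rewrite [1 + n^-1 - 1]addrAC subrr add0r lerD2l ler_wpM2r//.
  by move: p3; set p := (2 + s)^-1; lra.
have r2 : 0 <= n * rate s n ^+ 2 by rewrite mulr_ge0 ?sqr_ge0// ltW.
apply: le_trans (ler_wpM2l r2 HB'); rewrite le_eqVlt; apply/orP; left; apply/eqP.
by field; rewrite gt_eqF.
Qed.

End Rate.
End Recursion.

(** * The recursion for the expected error and the induction *)

Lemma step_value_le (R : realType) (k : scalar_kind) (V : hilbertType k R)
  (P : {linear V -> V}) (psi : nat -> V) (lambda : nat -> R) (L s sigma2 U n a c : R) (u v : V) :
  (forall v w, ip (P v) w = ip (P w) v) -> (forall v, 0 <= ip (P v) v) ->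
  (forall v, ip (P v) v <= L * hnorm v ^+ 2) ->
  complete_orthonormal psi ->
  (forall i, P (psi i) = of_real k (lambda i) *: psi i) ->
  (forall i, 0 < lambda i) ->
  0 < s <= 1 -> 0 < L -> 0 <= sigma2 -> 1 <= n ->
  (forall m, \sum_(i < m) lambda i `^ (- s) * sre `|inner u (psi i)| ^+ 2 <= U) ->
  a = n / (n + 1) -> c = (1 / (2 * L)) / n `^ ((1 + s) / (2 + s)) ->
  hnorm (u - of_real k a *: v) ^+ 2
    - 2 * (a * c) * ip (P (u - of_real k a *: v)) (u - v)
    + (a * c) ^+ 2 * L * (ip (P (u - v)) (u - v) + sigma2)
  <= (n ^+ 2 + n * ((1 - s) / 2)) / (n + 1) ^+ 2 * hnorm (u - v) ^+ 2
     + rate s n ^+ 2 * (2 * L `^ s * U + sigma2 / (4 * L) + 2 * hnorm u ^+ 2) / (n + 1) ^+ 2.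
Proof.
move=> Psym Ppos Ple [psi_on psi_dense] Peigen lambda0 s01 L0 sig0 n1 uU aE cE0.
have n0 : 0 < n by exact: lt_le_trans n1.
have n1' : 0 < n + 1 by exact: addr_gt0.
have r0 : 0 < rate s n by exact: rate_gt0.
have [e eE] : exists e, e = u - v by exists (u - v).
rewrite -eE; set nu := rate s n in r0 *.
set q := (L / nu) `^ s.
have q0 : 0 < q by rewrite powR_gt0// divr_gt0.
have kq : (L / nu) `^ (s - 1) = q * nu / L.
  have k0 : 0 < L / nu by exact: divr_gt0.
  rewrite powRB ?(gt_eqF k0) ?implybT// powRr1 ?(ltW k0)//.
  by rewrite -/q; field; rewrite !gt_eqF.
have xb : 2 * ip u e <= s * nu / (2 * L) * ip (P e) e + (1 - s) / 2 * hnorm e ^+ 2 + 2 * q * U.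
  (* With kappa = L/nu and theta = 1/(2q), the coefficient of |e|^2 becomes (1-s)/2 and that of (P
     e, e) becomes s/2 times nu/L. *)
  have th0 : 0 < (2 * q)^-1 by rewrite invr_gt0 mulr_gt0.
  have := ip_smoothness psi_on Psym Ppos Peigen psi_dense lambda0 s01 e th0 (divr_gt0 L0 r0) uU.
  rewrite kq -/q; congr (_ <= _).
  by field; rewrite !gt_eqF.
have cs : 0 <= 4 * ip (P u) u + 4 * n * ip (P u) e + n ^+ 2 * ip (P e) e.
  have := Ppos (of_real k 2 *: u + of_real k n *: e).
  rewrite (linearD P) !(linearZ_LR P) /= !ipE (Psym e u); congr (_ <= _); ring.
have nq : n * q = L `^ s * nu ^+ 2 by exact: rate_powR.
(* Since 1 - a = 1/(n+1), damping turns the error into a convex combination of [u] and [e]. *)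
have vE : u - of_real k a *: v = of_real k (n + 1)^-1 *: u + of_real k a *: e.
  rewrite eE scalerBr addrA -scalerDl -of_realD.
  have -> : (n + 1)^-1 + a = 1 by rewrite aE; field; rewrite gt_eqF.
  by rewrite of_real1 scale1r.
have cE : c = nu / (2 * L * n).
  by rewrite cE0 rate_step// -/nu; field; rewrite !gt_eqF.
have n2 : 0 < (n + 1) ^+ 2 by exact: exprn_gt0.
rewrite vE -(ler_pM2l n2).
have := recursion_algebra L0 s01 (rate_bounds s01 n1) nq (sqr_ge0 (hnorm u)) (Ppos e) sig0 (Ple u) cs xb.
rewrite -/nu !hnorm2E (linearD P) !(linearZ_LR P) /=; clearbody nu.
rewrite !ipE (ipC e u) cE aE; congr (_ <= _).
  by field; rewrite !gt_eqF.
by field; rewrite !gt_eqF.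
Qed.

(** [xget] selects some representer of the difference; injectivity of the feature map forces it to
    be u - v. *)
Lemma rkhs_norm_feature (R : realType) (k : scalar_kind) (Y V : hilbertType k R) (Omega : Type)
  (Rs : Omega -> V -> Y) (u v : V) :
  (forall w x y, Rs w (x - y) = Rs w x - Rs w y) ->
  (forall v, (forall w, Rs w v = 0) -> v = 0) ->
  rkhs_norm Rs (feature_fun Rs u \- feature_fun Rs v) = hnorm (u - v).
Proof.
move=> RsB Rs0; rewrite /rkhs_norm; congr hnorm; case: xgetP => [x _ /= xE|/(_ (u - v))[]].
  apply/subr0_eq/Rs0 => w; rewrite RsB (RsB _ u).
  by have := congr1 (fun f => f w) xE; rewrite /feature_fun /= => ->; rewrite subrr.
by apply/funext => w; rewrite /feature_fun RsB.
Qed.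

Theorem theorem1
  (R : realType) (k : scalar_kind) (Y V : hilbertType k R) (Omega : pmetricType R)
  (hYsep : separable Y) (hVsep : separable V) (hVinf : infinite_dimensional V)
  (hOmega : compact [set: Omega])
  (mu : probability (borel (Omega * Y)%type) R)
  (rho : probability (borel Omega) R)
  (hrho : forall B : set (borel Omega), measurable B -> rho B = mu (fst @^-1` B))
  (hy2 : (\int[mu]_z (hnorm z.2 ^+ 2)%:E < +oo)%E)
  (Rop : Omega -> {linear Y -> V}) (Rs : Omega -> V -> Y) (Lambda : R)
  (hRcont : forall w, continuous (Rop w))
  (hRs : forall w, is_adjoint (Rop w) (Rs w))
  (hRmeas : forall (y : Y) (v : V),
     measurable_fun [set: borel Omega]
       ((fun w => inner (Rop w y) v) : borel Omega -> borel (scalars k R)))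
  (hRbound : forall w, opnorm (Rop w) ^+ 2 <= Lambda)
  (P : {linear V -> V}) (hPcont : continuous P)
  (hP : forall v w : V,
     inner (P v) w = scalar_integral rho (fun o => inner (Rs o v) (Rs o w)))
  (hPinj : injective P) (hPcompact : compact_operator P)
  (ERy : V) (hERy : is_bochner_integral mu (fun z => Rop z.1 z.2) ERy)
  (u : V) (hu : P u = ERy)
  (psi : nat -> V) (lambda : nat -> R)
  (hpsi : complete_orthonormal psi)
  (heigen : forall i, P (psi i) = of_real k (lambda i) *: psi i)
  (hlambda_decr : forall i, lambda i.+1 <= lambda i)
  (hlambda_pos : forall i, 0 < lambda i)
  (hlambda_cvg : lambda @ \oo --> (0 : R))
  (s : R) (hs0 : 0 < s) (hs1 : s <= 1)
  (hus : (smoothness_norm2 psi lambda s u < +oo)%E)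
  (d : measure_display) (T : measurableType d) (Pr : probability T R)
  (N : option nat) (X : nat -> T -> borel (Omega * Y)%type)
  (hX : iid_samples Pr mu (in_horizon N) X)
  (u0 : V) :
  let A := 1 / (2 * Lambda) in
  let t := (1 + s) / (2 + s) in
  let um (m : nat) (x : T) := online_iterate Rop Rs A t u0 (fun j => X j x) m in
  let sigma2 := Rintegral mu setT (fun z => hnorm (z.2 - Rs z.1 u) ^+ 2) in
  let C2 := 2 * hnorm (u - u0) ^+ 2 + 2 * hnorm u ^+ 2
            + 8 * Lambda `^ s * fine (smoothness_norm2 psi lambda s u)
            + sigma2 / Lambda in
  forall m : nat, (1 <= m)%N -> in_horizon N m.-1 ->
    'E_Pr[fun x => (hnorm (u - um m x) ^+ 2)%R]%E =
    'E_Pr[fun x => (rkhs_norm Rs (feature_fun Rs u \- feature_fun Rs (um m x)) ^+ 2)%R]%E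
    /\
    ('E_Pr[fun x => (hnorm (u - um m x) ^+ 2)%R]
       <= (C2 * m.+1%:R `^ (- (s / (2 + s))))%:E)%E.
Proof.
move=> A t um sigma2 C2.
have Psym := ipP_sym hYsep hVsep hrho hy2 hRcont hRs hRmeas hRbound hP.
have Ppos := ipP_ge0 hYsep hVsep hrho hy2 hRcont hRs hRmeas hRbound hP.
have Ple := ipP_le hYsep hVsep hrho hy2 hRcont hRs hRmeas hRbound hP.
have s01 : 0 < s <= 1 by rewrite hs0.
have psi0 : ip (psi 0%N) (psi 0%N) = 1.
  by rewrite /ip hpsi.1 eqxx -(@of_real1 k) sre_of_real.
(* Positivity comes from the spectrum: [lambda 0] = (P psi_0, psi_0) <= [Lambda]. *)
have L0 : 0 < Lambda.
  have := Ple (psi 0%N); rewrite heigen hnorm2E ipZl psi0 !mulr1.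
  exact: lt_le_trans.
set U := fine (smoothness_norm2 psi lambda s u) in C2 *.
have uU m : \sum_(i < m) lambda i `^ (- s) * sre `|inner u (psi i)| ^+ 2 <= U.
  rewrite -lee_fin /U fineK; last first.
    rewrite ge0_fin_numE// /smoothness_norm2 nneseries_ge0// => i _ _.
    by rewrite lee_fin mulr_ge0 ?powR_ge0 ?sqr_ge0.
  rewrite -sumEFin /smoothness_norm2 -(big_mkord xpredT
    (fun i => (lambda i `^ (- s) * sre `|inner u (psi i)| ^+ 2)%:E)).
  by apply: nneseries_lim_ge => i _ _; rewrite lee_fin mulr_ge0 ?powR_ge0 ?sqr_ge0.
have U0 : 0 <= U by have := uU 0%N; rewrite big_ord0.
have sig0 : 0 <= sigma2 by apply: Rintegral_ge0 => z _; exact: sqr_ge0.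
have Ls0 : 0 <= Lambda `^ s by exact: powR_ge0.
have LsU : 0 <= Lambda `^ s * U by exact: mulr_ge0.
have sL : 0 <= sigma2 / Lambda by rewrite divr_ge0// ltW.
have sL4 : sigma2 / (4 * Lambda) = 4^-1 * (sigma2 / Lambda) by field; rewrite gt_eqF.
have hu0 := sqr_ge0 (hnorm u); have hu1 := sqr_ge0 (hnorm (u - u0)).
pose B := 2 * Lambda `^ s * U + sigma2 / (4 * Lambda) + 2 * hnorm u ^+ 2.
have BC : B <= C2 by rewrite /B /C2 sL4; lra.
have C20 : 0 <= C2 by rewrite /C2; lra.
have [mX _ _] := hX.
(* The induction starts at m = 0, where the term 2 |u - u0|^2 of [C2] suffices. Iterate m + 1 uses
   the samples 0, ..., m, hence the shifted horizon. *)
have main m : in_horizon N m.-1 ->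
  (\int[Pr]_x (hnorm (u - um m x) ^+ 2)%:E <= (C2 * m.+1%:R `^ (- (s / (2 + s))))%:E)%E.
  elim: m => [|m ih] hm.
    have [i0 e0] := Rintegral_cstP Pr (hnorm (u - u0) ^+ 2).
    rewrite powR1 mulr1 -[leLHS]fineK; last exact: (integrable_fin_num measurableT i0).
    by move: e0; rewrite /Rintegral lee_fin => ->; rewrite /C2; lra.
  have hle i : (i <= m)%N -> in_horizon N i.
    by move: hm; rewrite /in_horizon /=; case: (N) => // j mj im; exact: leq_trans im mj.
  have n1 : 1 <= m.+1%:R :> R by rewrite ler1n.
  set n : R := m.+1%:R in n1.
  have nS : m.+2%:R = n + 1 :> R by rewrite -[m.+2]addn1 natrD.
  have n0 : 0 < n by exact: lt_le_trans n1.
  have n1' : 0 < n + 1 by exact: addr_gt0.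
  pose a := (n ^+ 2 + n * ((1 - s) / 2)) / (n + 1) ^+ 2.
  pose b := rate s n ^+ 2 * B / (n + 1) ^+ 2.
  have n2 : 0 < (n + 1) ^+ 2 by exact: exprn_gt0.
  have a0 : 0 <= a.
    rewrite /a divr_ge0 ?sqr_ge0// addr_ge0 ?sqr_ge0//.
    by rewrite mulr_ge0 ?divr_ge0 ?subr_ge0 ?(ltW n0).
  have B0 : 0 <= B by rewrite /B sL4; lra.
  have b0 : 0 <= b by rewrite /b divr_ge0 ?sqr_ge0// mulr_ge0// sqr_ge0.
  have pind C : <<s past X m >> C -> _ := past_indep hX hle.
  have mstep d1 (T1 : measurableType d1) (Z : T1 -> borel (Omega * Y)%type) (W : T1 -> V) :
      measurable_fun setT Z -> weakly_measurable W ->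
      measurable_fun setT (fun x =>
        hnorm (u - online_step Rop Rs (n / (n + 1)) (A / n `^ t) (W x) (Z x)) ^+ 2).
    move=> mZ mW; apply: measurable_hnorm2 => //.
    apply: weakly_measurableB; first exact: weakly_measurable_cst.
    exact: weakly_measurable_step.
  (* Sample [m] is integrated against [um m], which depends on earlier samples only; the role of [K]
     is played by the bound of the induction hypothesis. *)
  have := @integral_indep_le k R V _ T _ _ Pr mu (X m) (past X m) (um m) hVsep
    (mX m (hle m (leqnn m))) (fun C pC => (pind C pC).1) (fun C D pC => (pind C pC).2 D) _
    (fun v z => hnorm (u - online_step Rop Rs (n / (n + 1)) (A / n `^ t) v z) ^+ 2) u a b
    (C2 * n `^ (- (s / (2 + s)))).
  move=> /(_ _ _ _ _ _ a0 b0) step.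
  have -> : um m.+1 = (fun x => online_step Rop Rs (n / (n + 1)) (A / n `^ t) (um m x) (X m x)).
    by rewrite /um /n -nS.
  apply: le_trans (step _ _ _ _ _ _ _) _.
  - apply: (weakly_measurable_iterate hYsep hVsep hRs hRmeas) => i im.
    exact: past_measurable_fun.
  - by move=> v z; exact: sqr_ge0.
  - move=> v; apply: mstep; first exact: measurable_id.
    exact: weakly_measurable_cst.
  - move=> W mW; apply: mstep => //; exact: mX (hle m (leqnn m)).
  - by move=> z v q vq; exact: cvg_hnorm2_step.
  - move=> v.
    have c0 : 0 <= A / n `^ t by rewrite divr_ge0 ?powR_ge0// divr_ge0// mulr_ge0// ltW.
    have an0 : 0 <= n / (n + 1) by rewrite divr_ge0 ?(ltW n0) ?(ltW n1').
    apply: le_trans (integral_step_le hYsep hVsep hrho hy2 hRcont hRs hRmeas hRbound hP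
      hERy hu v an0 c0) _.
    rewrite lee_fin.
    exact: (step_value_le v Psym Ppos Ple hpsi heigen hlambda_pos s01 L0 sig0 n1 uU
      erefl erefl).
  - by apply: ih; exact: hle (leq_pred m).
  rewrite lee_fin nS !rate_sqr ?lerDr ?(ltW n0)//.
  rewrite /a /b; set r := rate s n.
  have rs := rate_succ s01 n1; rewrite -/r in rs.
  have r0 : 0 <= r ^+ 2 by exact: sqr_ge0.
  (* In units of C2 r^2 / (n+1)^2, the old error contributes n + (1-s)/2 and the new term at most 1
     because B <= C2; the sum is at most n + 3/2. *)
  apply: (@le_trans _ _ (C2 * (r ^+ 2 * (n + 3 / 2)) / (n + 1) ^+ 2)).
    rewrite [_ * (C2 * _)](_ : _ = (C2 * (r ^+ 2 * (n + (1 - s) / 2))) / (n + 1) ^+ 2); last first.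
      by field; rewrite !gt_eqF.
    rewrite -mulrDl ler_wpM2r ?invr_ge0 ?sqr_ge0//.
    have := ler_wpM2l r0 BC; have := mulr_ge0 (mulr_ge0 C20 r0) (ltW hs0); lra.
  rewrite ler_pdivrMr//.
  have := ler_wpM2l C20 rs; congr (_ <= _).
  by field; rewrite gt_eqF.
move=> m m1 hm; rewrite !unlock; split; last exact: main.
apply: eq_integral => x _; congr (_ ^+ 2)%:E; rewrite rkhs_norm_feature//.
  by move=> w v v'; rewrite (adjointD (hRs w)) (adjointN (hRs w)).
(* If all [Rs w v] vanish, the integral representation gives (P v, w) = 0 for every w, so P v = 0
   and injectivity of [P] yields v = 0. *)
move=> v v0; apply: hPinj; rewrite linear0; apply: ip_ext => w; rewrite ip0l.
rewrite -(Rintegral_RsRs hYsep hVsep hrho hy2 hRcont hRs hRmeas hRbound hP v w).2.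
under eq_Rintegral do rewrite v0 ip0l.
by rewrite (Rintegral_cstP mu 0).2.
Qed.
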